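(* Let $K$ be a field of positive characteristic $p$ and let $R$ be a local Noetherian $K$-algebra of dimension $d$ with maximal ideal $\mathfrak m$. Let $A$ be an $R$-algebra. Then the following are equivalent. (i) $A$ is a parasolid $R$-algebra. (ii) There exists a paraclass $c\in H^d_{\mathfrak m}(R)$ which does not vanish in $H^d_{\mathfrak m}(A)$. (iii) $H^d_{\mathfrak m}(A)\neq 0$.
   Context: All rings are commutative with $1$. Let $R$ be a Noetherian local ring of dimension $d$ with maximal ideal $\mathfrak{m}$. Elements $x_1,\ldots,x_d\in R$ are called parameters if $V(x_1,\ldots,x_d)=V(\mathfrak{m})$; they define, via Čech cohomology, a class $1/(x_1\cdots x_d)\in H^d_{\mathfrak m}(R)$, called a paraclass. For an $R$-algebra $A$, $H^d_{\mathfrak m}(A)$ is the local cohomology of $A$ as an $R$-module. $A$ is called parasolid if every paraclass $0\neq c\in H^d_{\mathfrak m}(R)$ has non-zero image in $H^d_{\mathfrak m}(A)$. *)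

(* Defs.v *)
From HB Require Import structures.
From mathcomp Require Import all_boot all_order all_algebra.
From mathcomp Require Import boolp classical_sets.
From mathcomp Require Import zify.

Set Implicit Arguments.
Unset Strict Implicit.
Unset Printing Implicit Defensive.

Import GRing.Theory.

Local Open Scope ring_scope.
Local Open Scope quotient_scope.
Local Open Scope classical_set_scope.

Section Ideals.
Variable R : comNzRingType.
Implicit Types (I J P S : set R).

Definition is_ideal I :=
  [/\ I 0, (forall a b, I a -> I b -> I (a + b)) & (forall r a, I a -> I (r * a))].

Definition prime_ideal P :=
  [/\ is_ideal P, ~ P 1 & forall a b, P (a * b) -> P a \/ P b].

Definition maximal_ideal I :=
  [/\ is_ideal I, ~ I 1 & forall J, is_ideal J -> ~ J 1 -> I `<=` J -> J = I].

Definition ideal_span (s : seq R) : set R :=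
  [set a | exists c : 'I_(size s) -> R, a = \sum_(i < size s) c i * s`_i].

Definition noetherian :=
  forall I, is_ideal I -> exists s : seq R, ideal_span s = I.

Definition local_with_max (m : set R) :=
  maximal_ideal m /\ forall n, maximal_ideal n -> n = m.

Definition prime_chain n :=
  exists P : 'I_n.+1 -> set R, (forall i, prime_ideal (P i)) /\
    forall i j : 'I_n.+1, (i < j)%N -> P i `<` P j.

Definition krull_dim (d : nat) :=
  prime_chain d /\ forall n, prime_chain n -> (n <= d)%N.

Definition zero_locus S : set (set R) := [set P | prime_ideal P /\ S `<=` P].

Definition parameters (m : set R) d (x : d.-tuple R) :=
  zero_locus [set` x] = zero_locus m.

End Ideals.

Section Localization.
Variables (R : comNzRingType) (M : lmodType R) (f : R).

(* (a, n) stands for a / f ^ n *)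
Definition loc_eq (u v : M * nat) : bool :=
  `[< exists k, f ^+ (k + v.2) *: u.1 = f ^+ (k + u.2) *: v.1 >].

Lemma loc_eq_refl : reflexive loc_eq.
Proof. by move=> u; apply/asboolP; exists 0. Qed.

Lemma loc_eq_sym : symmetric loc_eq.
Proof. by move=> u v; apply/asboolP/asboolP => -[k E]; exists k. Qed.

Lemma loc_eq_trans : transitive loc_eq.
Proof.
move=> v u w /asboolP[k E] /asboolP[l F]; apply/asboolP.
exists (k + l + v.2)%N.
have -> : (k + l + v.2 + w.2 = (l + w.2) + (k + v.2))%N by lia.
have -> : (k + l + v.2 + u.2 = (k + u.2) + (l + v.2))%N by lia.
by rewrite exprD -scalerA E scalerA mulrC -scalerA F scalerA -exprD.
Qed.

Canonical loc_equiv := EquivRel loc_eq loc_eq_refl loc_eq_sym loc_eq_trans.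

Definition loc := {eq_quot loc_equiv}.

HB.instance Definition _ := EqQuotient.on loc.
HB.instance Definition _ := Choice.on loc.

Definition frac (a : M) (n : nat) : loc := \pi_loc (a, n).

Lemma frac_eqP a n b k :
  reflect (exists l, f ^+ (l + k) *: a = f ^+ (l + n) *: b)
          (frac a n == frac b k).
Proof. by rewrite /frac eqmodE; apply: asboolP. Qed.

Lemma fracP u : exists a n, u = frac a n.
Proof. by exists (repr u).1, (repr u).2; rewrite /frac -surjective_pairing reprK. Qed.

Lemma frac_expand a n k : frac a n = frac (f ^+ k *: a) (k + n).
Proof.
by apply/eqP/frac_eqP; exists 0%N; rewrite !add0n scalerA -exprD addnC.
Qed.

Definition loc_zero : loc := frac 0 0.

Definition loc_add (u v : loc) : loc :=
  frac (f ^+ (repr v).2 *: (repr u).1 + f ^+ (repr u).2 *: (repr v).1)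
       ((repr u).2 + (repr v).2).

Definition loc_opp (u : loc) : loc := frac (- (repr u).1) (repr u).2.

Definition loc_scale (r : R) (u : loc) : loc := frac (r *: (repr u).1) (repr u).2.

Lemma repr_frac a n :
  exists l, f ^+ (l + n) *: (repr (frac a n)).1
            = f ^+ (l + (repr (frac a n)).2) *: a.
Proof.
apply/frac_eqP; rewrite {1}/frac -surjective_pairing reprK; exact: eqxx.
Qed.

Lemma loc_addE a n b k :
  loc_add (frac a n) (frac b k) = frac (f ^+ k *: a + f ^+ n *: b) (n + k).
Proof.
have [l E] := repr_frac a n; have [j F] := repr_frac b k.
rewrite /loc_add; move: (repr (frac a n)) (repr (frac b k)) E F.
move=> [a' n'] [b' k'] /= E F; apply/eqP/frac_eqP; exists (l + j)%N.
rewrite !scalerDr !scalerA -!exprD; congr (_ + _).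
  have -> : (l + j + (n + k) + k' = (j + k + k') + (l + n))%N by lia.
  by rewrite exprD -scalerA E scalerA -exprD; congr (_ ^+ _ *: _); lia.
have -> : (l + j + (n + k) + n' = (l + n + n') + (j + k))%N by lia.
by rewrite exprD -scalerA F scalerA -exprD; congr (_ ^+ _ *: _); lia.
Qed.

Lemma loc_oppE a n : loc_opp (frac a n) = frac (- a) n.
Proof.
have [l E] := repr_frac a n; apply/eqP/frac_eqP; exists l.
by rewrite !scalerN E.
Qed.

Lemma loc_scaleE r a n : loc_scale r (frac a n) = frac (r *: a) n.
Proof.
have [l E] := repr_frac a n; apply/eqP/frac_eqP; exists l.
by rewrite scalerA mulrC -scalerA E !scalerA [r * _]mulrC.
Qed.

Lemma loc_addA : associative loc_add.
Proof.
move=> u v w; have [[a [n ->]] [b [k ->]] [c [j ->]]] := And3 (fracP u) (fracP v) (fracP w).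
rewrite !loc_addE; congr frac; last exact: addnA.
by rewrite !scalerDr !scalerA -!exprD addrA [(j + k)%N]addnC [(j + n)%N]addnC.
Qed.

Lemma loc_addC : commutative loc_add.
Proof.
move=> u v; have [[a [n ->]] [b [k ->]]] := conj (fracP u) (fracP v).
by rewrite !loc_addE addrC addnC.
Qed.

Lemma loc_add0 : left_id loc_zero loc_add.
Proof.
move=> u; have [a [n ->]] := fracP u.
by rewrite loc_addE scaler0 add0r expr0 scale1r.
Qed.

Lemma loc_addN : left_inverse loc_zero loc_opp loc_add.
Proof.
move=> u; have [a [n ->]] := fracP u; rewrite loc_oppE loc_addE.
by apply/eqP/frac_eqP; exists 0%N; rewrite scalerN addNr !scaler0.
Qed.

HB.instance Definition _ :=
  GRing.isZmodule.Build loc loc_addA loc_addC loc_add0 loc_addN.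

Lemma fracD a n b k :
  frac a n + frac b k = frac (f ^+ k *: a + f ^+ n *: b) (n + k).
Proof. exact: loc_addE. Qed.

Lemma loc_scaleA r s u : loc_scale r (loc_scale s u) = loc_scale (r * s) u.
Proof. by have [a [n ->]] := fracP u; rewrite !loc_scaleE scalerA. Qed.

Lemma loc_scale1 : left_id 1 loc_scale.
Proof. by move=> u; have [a [n ->]] := fracP u; rewrite loc_scaleE scale1r. Qed.

Lemma loc_scaleDr : right_distributive loc_scale +%R.
Proof.
move=> r u v; have [[a [n ->]] [b [k ->]]] := conj (fracP u) (fracP v).
rewrite fracD !loc_scaleE fracD scalerDr !scalerA.
by rewrite ![r * _]mulrC.
Qed.

Lemma loc_scaleDl u : {morph loc_scale^~ u : r s / r + s}.
Proof.
move=> r s; have [a [n ->]] := fracP u; rewrite !loc_scaleE fracD.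
rewrite scalerDl; apply/eqP/frac_eqP; exists 0%N; rewrite !add0n -scalerDr.
by rewrite scalerA -exprD.
Qed.

HB.instance Definition _ := GRing.Zmodule_isLmodule.Build R loc
  loc_scaleA loc_scale1 loc_scaleDr loc_scaleDl.

Lemma fracZ r a n : r *: frac a n = frac (r *: a) n.
Proof. exact: loc_scaleE. Qed.

Definition to_loc (a : M) : loc := frac a 0.

Lemma to_loc_linear : linear to_loc.
Proof.
by move=> r a b; rewrite /to_loc fracZ fracD !expr0 !scale1r.
Qed.

HB.instance Definition _ := GRing.isLinear.Build R M loc _ to_loc to_loc_linear.

End Localization.

Section LocalizationMap.
Variables (R : comNzRingType) (M N : lmodType R) (f : R) (g : {linear M -> N}).

Definition loc_fun (u : loc M f) : loc N f := frac f (g (repr u).1) (repr u).2.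

Lemma loc_funE a n : loc_fun (frac f a n) = frac f (g a) n.
Proof.
have [l E] := repr_frac f a n; apply/eqP/frac_eqP; exists l.
by rewrite -!linearZ /= E.
Qed.

Lemma loc_fun_linear : linear loc_fun.
Proof.
move=> r u v; have [[a [n ->]] [b [k ->]]] := conj (fracP u) (fracP v).
have gZ c x : g (c *: x) = c *: g x by exact: linearZ_LR.
have gD x y : g (x + y) = g x + g y by exact: raddfD.
by rewrite fracZ fracD !loc_funE fracZ fracD gD !gZ.
Qed.

HB.instance Definition _ :=
  GRing.isLinear.Build R (loc M f) (loc N f) _ loc_fun loc_fun_linear.

End LocalizationMap.

Section Homology.
Variables (R : comNzRingType) (U V W : lmodType R).
Variables (f : {linear U -> V}) (g : {linear V -> W}).

Definition kernel := {v : V | g v == 0}.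

HB.instance Definition _ := SubChoice.on kernel.

Lemma kernel_submod : submod_closed [pred v | g v == 0].
Proof.
split=> [|r v w]; rewrite !inE ?linear0 // => /eqP gv /eqP gw.
by rewrite linearP gv gw scaler0 addr0.
Qed.

HB.instance Definition _ := GRing.SubChoice_isSubLmodule.Build R V
  [pred v | g v == 0] kernel (GRing.submod_closed_semi kernel_submod).

Definition hom_eq (z w : kernel) : bool := `[< exists u, f u = val z - val w >].

Lemma hom_eq_refl : reflexive hom_eq.
Proof. by move=> z; apply/asboolP; exists 0; rewrite linear0 subrr. Qed.

Lemma hom_eq_sym : symmetric hom_eq.
Proof.
by move=> z w; apply/asboolP/asboolP => -[u E]; exists (- u);
   rewrite linearN E opprB.
Qed.

Lemma hom_eq_trans : transitive hom_eq.
Proof.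
move=> y x z /asboolP[u E] /asboolP[v F]; apply/asboolP; exists (u + v).
by rewrite linearD E F addrA subrK.
Qed.

Canonical hom_equiv := EquivRel hom_eq hom_eq_refl hom_eq_sym hom_eq_trans.

(* Ker g / (Im f \cap Ker g) *)
Definition homology := {eq_quot hom_equiv}.

HB.instance Definition _ := EqQuotient.on homology.
HB.instance Definition _ := Choice.on homology.

Definition hclass (z : kernel) : homology := \pi_homology z.

Lemma hclass_eqP z w :
  reflect (exists u, f u = val z - val w) (hclass z == hclass w).
Proof. by rewrite /hclass eqmodE; apply: asboolP. Qed.

Lemma hclassP c : exists z, c = hclass z.
Proof. by exists (repr c); rewrite /hclass reprK. Qed.

Lemma repr_hclass z : exists u, f u = val (repr (hclass z)) - val z.
Proof. by apply/hclass_eqP; rewrite {1}/hclass reprK. Qed.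

Definition hom_zero : homology := hclass 0.
Definition hom_opp (c : homology) : homology := hclass (- repr c).
Definition hom_add (c e : homology) : homology := hclass (repr c + repr e).
Definition hom_scale (r : R) (c : homology) : homology := hclass (r *: repr c).

Lemma hom_addE z w : hom_add (hclass z) (hclass w) = hclass (z + w).
Proof.
have [[u E] [v F]] := conj (repr_hclass z) (repr_hclass w).
by apply/eqP/hclass_eqP; exists (u + v); rewrite linearD E F !raddfD /= addrACA.
Qed.

Lemma hom_oppE z : hom_opp (hclass z) = hclass (- z).
Proof.
have [u E] := repr_hclass z.
by apply/eqP/hclass_eqP; exists (- u); rewrite linearN E !raddfN /= opprB opprK addrC.
Qed.

Lemma hom_scaleE r z : hom_scale r (hclass z) = hclass (r *: z).
Proof.
have [u E] := repr_hclass z.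
apply/eqP/hclass_eqP; exists (r *: u).
have -> : f (r *: u) = r *: f u by exact: linearZ_LR.
by rewrite E scalerBr; congr (_ - _); symmetry; exact: linearZ_LR.
Qed.

Lemma hom_addA : associative hom_add.
Proof.
move=> a b c; have [[x ->] [y ->] [z ->]] := And3 (hclassP a) (hclassP b) (hclassP c).
by rewrite !hom_addE addrA.
Qed.

Lemma hom_addC : commutative hom_add.
Proof.
move=> a b; have [[x ->] [y ->]] := conj (hclassP a) (hclassP b).
by rewrite !hom_addE addrC.
Qed.

Lemma hom_add0 : left_id hom_zero hom_add.
Proof. by move=> a; have [x ->] := hclassP a; rewrite hom_addE add0r. Qed.

Lemma hom_addN : left_inverse hom_zero hom_opp hom_add.
Proof. by move=> a; have [x ->] := hclassP a; rewrite hom_oppE hom_addE addNr. Qed.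

HB.instance Definition _ :=
  GRing.isZmodule.Build homology hom_addA hom_addC hom_add0 hom_addN.

Lemma hclassD z w : hclass z + hclass w = hclass (z + w).
Proof. exact: hom_addE. Qed.

Lemma hom_scaleA r s c : hom_scale r (hom_scale s c) = hom_scale (r * s) c.
Proof. by have [x ->] := hclassP c; rewrite !hom_scaleE scalerA. Qed.

Lemma hom_scale1 : left_id 1 hom_scale.
Proof. by move=> c; have [x ->] := hclassP c; rewrite hom_scaleE scale1r. Qed.

Lemma hom_scaleDr : right_distributive hom_scale +%R.
Proof.
move=> r a b; have [[x ->] [y ->]] := conj (hclassP a) (hclassP b).
by rewrite hclassD !hom_scaleE hclassD scalerDr.
Qed.

Lemma hom_scaleDl c : {morph hom_scale^~ c : r s / r + s}.
Proof.
by move=> r s; have [x ->] := hclassP c; rewrite !hom_scaleE hclassD scalerDl.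
Qed.

HB.instance Definition _ := GRing.Zmodule_isLmodule.Build R homology
  hom_scaleA hom_scale1 hom_scaleDr hom_scaleDl.

Lemma hclassZ r z : r *: hclass z = hclass (r *: z).
Proof. exact: hom_scaleE. Qed.

Lemma hclass_linear : linear hclass.
Proof. by move=> r z w; rewrite hclassZ hclassD. Qed.

HB.instance Definition _ :=
  GRing.isLinear.Build R kernel homology _ hclass hclass_linear.

Lemma hclass_eq0P z : reflect (exists u, f u = val z) (hclass z == 0).
Proof.
have E : val z - val (0 : kernel) = val z by rewrite [val 0]raddf0 subr0.
by apply: (iffP (hclass_eqP z 0)); rewrite E.
Qed.

End Homology.

Section HomologyMap.
Variables (R : comNzRingType) (U V W U' V' W' : lmodType R).
Variables (f : {linear U -> V}) (g : {linear V -> W}).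
Variables (f' : {linear U' -> V'}) (g' : {linear V' -> W'}).
Variables (phi : {linear V -> V'}).
Hypothesis phi_ker : forall v, g v = 0 -> g' (phi v) = 0.

Lemma kernel_map_subproof (z : kernel g) : g' (phi (val z)) == 0.
Proof. by apply/eqP/phi_ker/eqP; exact: valP z. Qed.

Definition kernel_map (z : kernel g) : kernel g' :=
  Sub (phi (val z)) (kernel_map_subproof z).

Definition homology_map (c : homology f g) : homology f' g' :=
  hclass f' (kernel_map (repr c)).

Lemma homology_mapE (phi_im : forall u, exists u', phi (f u) = f' u') z :
  homology_map (hclass f z) = hclass f' (kernel_map z).
Proof.
have [u E] := repr_hclass f z; have [u' F] := phi_im u.
apply/eqP/hclass_eqP; exists u'; rewrite -F E; exact: raddfB.
Qed.

End HomologyMap.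

Arguments homology_map {R U V W U' V' W'} f g f' g' phi phi_ker c.

(* [cech ys M k] is the degree-k term of
      [(R -> R_{y1}) (x) ... (x) (R -> R_{yn}) (x) M],
    that is, the direct sum of the localizations of [M] at the products
    [y_{i1} ... y_{ik}], [i1 < ... < ik]; localizing at a product is written as
    successive localizations.  Adding [y] in front forms the cone of
    [cech ys M -> cech ys (loc M y)]: of a pair [(a, b)], [a] collects the
    components whose index set does not contain [y], and [b] the others. *)

Section Cech.
Variable R : comNzRingType.

Fixpoint cech (ys : seq R) (M : lmodType R) (k : nat) : lmodType R :=
  match ys, k with
  | [::], 0 => M
  | [::], _.+1 => 'rV[R]_0
  | y :: ys', 0 => cech ys' M 0
  | y :: ys', k'.+1 => (cech ys' M k'.+1 * cech ys' (loc M y) k')%type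
  end.

Fixpoint cech_map (ys : seq R) (M N : lmodType R) (g : {linear M -> N}) k :
    cech ys M k -> cech ys N k :=
  match ys, k return cech ys M k -> cech ys N k with
  | [::], 0 => g
  | [::], _.+1 => id
  | y :: ys', 0 => @cech_map ys' M N g 0
  | y :: ys', k'.+1 => fun ab =>
      (@cech_map ys' M N g k'.+1 ab.1,
       @cech_map ys' _ _ (@loc_fun R M N y g) k' ab.2)
  end.

Fixpoint cech_diff (ys : seq R) (M : lmodType R) k :
    cech ys M k -> cech ys M k.+1 :=
  match ys, k return cech ys M k -> cech ys M k.+1 with
  | [::], _ => fun=> 0
  | y :: ys', 0 => fun a => (@cech_diff ys' M 0 a, @cech_map ys' _ _ (@to_loc R M y) 0 a)
  | y :: ys', k'.+1 => fun ab =>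
      (@cech_diff ys' M k'.+1 ab.1,
       @cech_map ys' _ _ (@to_loc R M y) k'.+1 ab.1 - @cech_diff ys' _ k' ab.2)
  end.

Lemma cech_map_linear ys (M N : lmodType R) (g : {linear M -> N}) k :
  linear (@cech_map ys M N g k).
Proof.
elim: ys M N g k => [|y ys IH] M N g [|k] /=.
- exact: linearP.
- by [].
- exact: IH.
- by move=> r [a b] [a' b'] /=; rewrite !IH.
Qed.

HB.instance Definition _ ys (M N : lmodType R) (g : {linear M -> N}) k :=
  GRing.isLinear.Build R (cech ys M k) (cech ys N k) _ (@cech_map ys M N g k)
    (@cech_map_linear ys M N g k).

Lemma cech_diff_linear ys (M : lmodType R) k : linear (@cech_diff ys M k).
Proof.
elim: ys M k => [|y ys IH] M [|k] /=.
- by move=> r a b; rewrite scaler0 addr0.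
- by move=> r a b; rewrite scaler0 addr0.
- by move=> r a b; rewrite IH cech_map_linear.
- move=> r [a b] [a' b'] /=; rewrite !IH cech_map_linear opprD addrACA.
  by rewrite -scalerBr.
Qed.

HB.instance Definition _ ys (M : lmodType R) k :=
  GRing.isLinear.Build R (cech ys M k) (cech ys M k.+1) _ (@cech_diff ys M k)
    (@cech_diff_linear ys M k).

Definition cech_pre (ys : seq R) (M : lmodType R) k : lmodType R :=
  if k is k'.+1 then cech ys M k' else 'rV[R]_0.

Definition cech_into ys (M : lmodType R) k : cech_pre ys M k -> cech ys M k :=
  match k return cech_pre ys M k -> cech ys M k with
  | 0 => fun=> 0
  | k'.+1 => @cech_diff ys M k'
  end.

Lemma cech_into_linear ys (M : lmodType R) k : linear (@cech_into ys M k).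
Proof.
case: k => [|k]; last exact: cech_diff_linear.
by move=> r a b; rewrite /= scaler0 addr0.
Qed.

HB.instance Definition _ ys (M : lmodType R) k :=
  GRing.isLinear.Build R (cech_pre ys M k) (cech ys M k) _ (@cech_into ys M k)
    (@cech_into_linear ys M k).

Definition cech_H (ys : seq R) (M : lmodType R) (k : nat) : lmodType R :=
  homology (@cech_into ys M k) (@cech_diff ys M k).

Lemma cech_map_square ys (M N M' N' : lmodType R) (g : {linear M -> N})
    (g' : {linear M' -> N'}) (h : {linear M -> M'}) (h' : {linear N -> N'}) k
    (a : cech ys M k) : (forall x, g' (h x) = h' (g x)) ->
  cech_map g' (cech_map h a) = cech_map h' (cech_map g a).
Proof.
elim: ys M N M' N' g g' h h' k a => [|y ys IH] M N M' N' g g' h h' [|k] //= a E.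
- exact: IH.
- congr pair; first exact: IH.
  by apply: IH => u; have [x [n ->]] := fracP u; rewrite /= !loc_funE E.
Qed.

Lemma cech_map_to_loc ys (M N : lmodType R) (g : {linear M -> N}) y k
    (a : cech ys M k) :
  cech_map (@to_loc R N y) (cech_map g a) =
  cech_map (@loc_fun R M N y g) (cech_map (@to_loc R M y) a).
Proof. by apply: cech_map_square => x; rewrite /= /to_loc loc_funE. Qed.

Lemma cech_diff_map ys (M N : lmodType R) (g : {linear M -> N}) k
    (a : cech ys M k) :
  cech_diff (cech_map g a) = cech_map g (cech_diff a).
Proof.
elim: ys M N g k a => [|y ys IH] M N g [|k] //= a.
  by rewrite IH cech_map_to_loc.
by rewrite !IH cech_map_to_loc raddfB.
Qed.

Lemma cech_diffK ys (M : lmodType R) k (a : cech ys M k) :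
  cech_diff (cech_diff a) = 0.
Proof.
elim: ys M k a => [|y ys IH] M [|k] //= a.
  by rewrite IH cech_diff_map subrr.
by rewrite IH raddfB /= IH subr0 cech_diff_map subrr.
Qed.

Lemma cech_map_ker ys (M N : lmodType R) (g : {linear M -> N}) k
    (a : cech ys M k) :
  cech_diff a = 0 -> cech_diff (cech_map g a) = 0.
Proof. by rewrite cech_diff_map => ->; rewrite raddf0. Qed.

Lemma cech_map_im ys (M N : lmodType R) (g : {linear M -> N}) k
    (u : cech_pre ys M k) :
  exists u', cech_map g (cech_into u) = @cech_into ys N k u'.
Proof.
case: k u => [|k] u; first by exists 0; rewrite /= raddf0.
by exists (cech_map g u); rewrite /= cech_diff_map.
Qed.

Definition cech_H_map ys (M N : lmodType R) (g : {linear M -> N}) k :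
    cech_H ys M k -> cech_H ys N k :=
  homology_map (@cech_into ys M k) (@cech_diff ys M k)
    (@cech_into ys N k) (@cech_diff ys N k)
    (@cech_map ys M N g k) (@cech_map_ker ys M N g k).

Lemma cech_H_mapE ys (M N : lmodType R) (g : {linear M -> N}) k z :
  @cech_H_map ys M N g k (hclass _ z) =
  hclass _ (kernel_map (@cech_map_ker ys M N g k) z).
Proof. exact/homology_mapE/cech_map_im. Qed.

(* Restriction of Cech cochains to a subfamily: the components whose index set
   is contained in the subfamily are kept. *)

Fixpoint cech_resr (us vs : seq R) (M : lmodType R) k :
    cech (us ++ vs) M k -> cech vs M k :=
  match us, k return cech (us ++ vs) M k -> cech vs M k with
  | [::], _ => id
  | u :: us', 0 => @cech_resr us' vs M 0
  | u :: us', k'.+1 => fun ab => @cech_resr us' vs M k'.+1 ab.1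
  end.

Fixpoint cech_res0 (vs : seq R) (M : lmodType R) k :
    cech vs M k -> cech [::] M k :=
  match vs, k return cech vs M k -> cech [::] M k with
  | [::], _ => id
  | v :: vs', 0 => @cech_res0 vs' M 0
  | v :: vs', k'.+1 => fun ab => @cech_res0 vs' M k'.+1 ab.1
  end.

Fixpoint cech_resl (us vs : seq R) (M : lmodType R) k :
    cech (us ++ vs) M k -> cech us M k :=
  match us, k return cech (us ++ vs) M k -> cech us M k with
  | [::], _ => @cech_res0 vs M _
  | u :: us', 0 => @cech_resl us' vs M 0
  | u :: us', k'.+1 => fun ab =>
      (@cech_resl us' vs M k'.+1 ab.1, @cech_resl us' vs (loc M u) k' ab.2)
  end.

Lemma cech_resr_linear us vs (M : lmodType R) k : linear (@cech_resr us vs M k).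
Proof.
elim: us M k => [|u us IH] M k; first by [].
case: k => [|k]; first exact: (IH M 0%N).
by move=> r [a b] [a' b'] /=; rewrite (IH M k.+1).
Qed.

HB.instance Definition _ us vs (M : lmodType R) k :=
  GRing.isLinear.Build R (cech (us ++ vs) M k) (cech vs M k) _
    (@cech_resr us vs M k) (@cech_resr_linear us vs M k).

Lemma cech_res0_linear vs (M : lmodType R) k : linear (@cech_res0 vs M k).
Proof.
elim: vs M k => [|v vs IH] M k; first by [].
case: k => [|k]; first exact: (IH M 0%N).
by move=> r [a b] [a' b'] /=; rewrite (IH M k.+1).
Qed.

Lemma cech_resl_linear us vs (M : lmodType R) k : linear (@cech_resl us vs M k).
Proof.
elim: us M k => [|u us IH] M k; first exact: cech_res0_linear.
case: k => [|k] /=; first exact: IH.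
by move=> r [a b] [a' b'] /=; rewrite !IH.
Qed.

HB.instance Definition _ us vs (M : lmodType R) k :=
  GRing.isLinear.Build R (cech (us ++ vs) M k) (cech us M k) _
    (@cech_resl us vs M k) (@cech_resl_linear us vs M k).

Lemma cech_resr_diff us vs (M : lmodType R) k (a : cech (us ++ vs) M k) :
  cech_resr (cech_diff a) = cech_diff (cech_resr a).
Proof. by elim: us M k a => [|u us IH] M [|k] //= a; rewrite IH. Qed.

Lemma cech_res0_diff vs (M : lmodType R) k (a : cech vs M k) :
  cech_res0 (cech_diff a) = 0.
Proof. by elim: vs M k a => [|v vs IH] M [|k] //= a; apply: IH. Qed.

Lemma cech_res0_map vs (M N : lmodType R) (g : {linear M -> N}) k
    (a : cech vs M k) :
  cech_res0 (cech_map g a) = @cech_map [::] M N g k (cech_res0 a).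
Proof.
by elim: vs M N g k a => [|v vs IH] M N g [|k] //= a; [apply: (IH _ _ g 0%N) | apply: (IH _ _ g k.+1)].
Qed.

Lemma cech_resl_map us vs (M N : lmodType R) (g : {linear M -> N}) k
    (a : cech (us ++ vs) M k) :
  cech_resl (cech_map g a) = cech_map g (cech_resl a).
Proof.
elim: us M N g k a => [|u us IH] M N g k a; first exact: cech_res0_map.
by case: k a => [|k] a /=; rewrite !IH.
Qed.

Lemma cech_resl_diff us vs (M : lmodType R) k (a : cech (us ++ vs) M k) :
  cech_resl (cech_diff a) = cech_diff (cech_resl a).
Proof.
elim: us M k a => [|u us IH] M k a; first exact: cech_res0_diff.
case: k a => [|k] a /=; first by rewrite IH cech_resl_map.
by rewrite IH raddfB /= IH cech_resl_map.
Qed.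

Lemma cech_resr_ker us vs (M : lmodType R) k (a : cech (us ++ vs) M k) :
  cech_diff a = 0 -> cech_diff (cech_resr a) = 0.
Proof. by rewrite -cech_resr_diff => ->; rewrite raddf0. Qed.

Lemma cech_resl_ker us vs (M : lmodType R) k (a : cech (us ++ vs) M k) :
  cech_diff a = 0 -> cech_diff (cech_resl a) = 0.
Proof. by rewrite -cech_resl_diff => ->; rewrite raddf0. Qed.

Lemma cech_resr_im us vs (M : lmodType R) k (u : cech_pre (us ++ vs) M k) :
  exists u', cech_resr (cech_into u) = @cech_into vs M k u'.
Proof.
case: k u => [|k] u; first by exists 0; rewrite /= raddf0.
by exists (cech_resr u); rewrite /= cech_resr_diff.
Qed.

Definition cech_H_resr us vs (M : lmodType R) k :
    cech_H (us ++ vs) M k -> cech_H vs M k :=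
  homology_map (@cech_into (us ++ vs) M k) (@cech_diff (us ++ vs) M k)
    (@cech_into vs M k) (@cech_diff vs M k) (@cech_resr us vs M k) (@cech_resr_ker us vs M k).

Lemma cech_H_resrE us vs (M : lmodType R) k z :
  @cech_H_resr us vs M k (hclass _ z) =
  hclass _ (kernel_map (@cech_resr_ker us vs M k) z).
Proof. exact/homology_mapE/cech_resr_im. Qed.

Lemma cech_resl_im us vs (M : lmodType R) k (u : cech_pre (us ++ vs) M k) :
  exists u', cech_resl (cech_into u) = @cech_into us M k u'.
Proof.
case: k u => [|k] u; first by exists 0; rewrite /= raddf0.
by exists (cech_resl u); rewrite /= cech_resl_diff.
Qed.

Definition cech_H_resl us vs (M : lmodType R) k :
    cech_H (us ++ vs) M k -> cech_H us M k :=
  homology_map (@cech_into (us ++ vs) M k) (@cech_diff (us ++ vs) M k)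
    (@cech_into us M k) (@cech_diff us M k) (@cech_resl us vs M k) (@cech_resl_ker us vs M k).

Lemma cech_H_reslE us vs (M : lmodType R) k z :
  @cech_H_resl us vs M k (hclass _ z) =
  hclass _ (kernel_map (@cech_resl_ker us vs M k) z).
Proof. exact/homology_mapE/cech_resl_im. Qed.

(* If [k = size xs], the cochain [a / (x1 ... xk)] in the top degree; otherwise
   this is 0 by convention. *)
Fixpoint cech_top (xs : seq R) (M : lmodType R) (a : M) k : cech xs M k :=
  match xs, k return cech xs M k with
  | [::], 0 => a
  | [::], _.+1 => 0
  | x :: xs', 0 => 0
  | x :: xs', k'.+1 => (0, @cech_top xs' (loc M x) (frac x a 1) k')
  end.

Lemma cech_top_cocycle xs (M : lmodType R) (a : M) k :
  cech_diff (cech_top xs a k) == 0.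
Proof.
apply/eqP; elim: xs M a k => [|x xs IH] M a [|k] //=.
  by rewrite !raddf0.
by rewrite IH !raddf0 addr0.
Qed.

Definition cech_top_class xs (M : lmodType R) (a : M) k : cech_H xs M k :=
  hclass (@cech_into xs M k) (Sub (cech_top xs a k) (cech_top_cocycle xs a k)).

End Cech.

Section LocalCohomology.
Variables (R : comNzRingType) (m : set R).

(* A chosen finite system of generators of [m]; it exists when [R] is
   Noetherian, and up to canonical isomorphism nothing depends on the choice. *)
Definition gens : seq R := xget [::] [set s | ideal_span s = m].

Definition local_cohomology (M : lmodType R) (k : nat) : lmodType R :=
  cech_H gens M k.

Definition lc_map (M N : lmodType R) (g : {linear M -> N}) k :
    local_cohomology M k -> local_cohomology N k :=
  @cech_H_map R gens M N g k.

(* The restriction maps from the Cech cohomology of the family [gens ++ x] to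
   that of [gens] and to that of [x] are isomorphisms when [x] is a sequence of
   parameters; they carry the class 1 / (x1 ... xd) over to [local_cohomology]. *)
Definition paraclass_of d (x : d.-tuple R) (c : local_cohomology R^o d) :=
  exists e : cech_H (gens ++ x) R^o d,
    cech_H_resl e = c /\ cech_H_resr e = cech_top_class x (1 : R^o) d.

Definition paraclass d (c : local_cohomology R^o d) :=
  exists x : d.-tuple R, parameters m x /\ paraclass_of x c.

End LocalCohomology.

(* An R-algebra is given by its structure morphism, which allows the zero ring. *)
Definition algebra_module (R : comNzRingType) (A : comPzRingType)
  (phi : {rmorphism R -> A}) : Type := A.

Section Algebras.
Variables (R : comNzRingType) (A : comPzRingType) (phi : {rmorphism R -> A}).

Notation alg_mod := (algebra_module phi).

HB.instance Definition _ := GRing.Zmodule.copy alg_mod A.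

Definition alg_scale (r : R) (a : alg_mod) : alg_mod := phi r * (a : A).

Lemma alg_scaleA r s a : alg_scale r (alg_scale s a) = alg_scale (r * s) a.
Proof. by rewrite /alg_scale rmorphM mulrA. Qed.

Lemma alg_scale1 : left_id 1 alg_scale.
Proof. by move=> a; rewrite /alg_scale rmorph1 mul1r. Qed.

Lemma alg_scaleDr : right_distributive alg_scale +%R.
Proof. by move=> r a b; exact: mulrDr. Qed.

Lemma alg_scaleDl a : {morph alg_scale^~ a : r s / r + s}.
Proof. by move=> r s; rewrite /alg_scale rmorphD; exact: mulrDl. Qed.

HB.instance Definition _ := GRing.Zmodule_isLmodule.Build R alg_mod
  alg_scaleA alg_scale1 alg_scaleDr alg_scaleDl.

Definition alg_map (r : R^o) : alg_mod := phi r.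

Lemma alg_map_linear : linear alg_map.
Proof. by move=> r a b; rewrite /alg_map rmorphD rmorphM. Qed.

HB.instance Definition _ :=
  GRing.isLinear.Build R R^o alg_mod _ alg_map alg_map_linear.

Variables (m : set R) (d : nat).

Definition lc_alg_map :
    local_cohomology m R^o d -> local_cohomology m alg_mod d :=
  @lc_map R m R^o alg_mod alg_map d.

Definition parasolid :=
  forall c : local_cohomology m R^o d, paraclass c -> c <> 0 -> lc_alg_map c <> 0.

End Algebras.

(* Main.v *)
(** (iii) => (i). If the paraclass of x_1, ..., x_d dies in A, then
    (x_1 ... x_d)^t lies in (x_1^(t+1), ..., x_d^(t+1))A for some t. Frobenius
    gives the same for all x_i^q and qt, which kills every element of H^d(A).
    (i) => (ii). There are parameters x_1, ..., x_d by prime avoidance, and their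
    class does not vanish: otherwise (x_1 ... x_d)^t lies in the ideal generated
    by the x_i^(t+1) in R, where t + 1 = Q may be taken to be a power of p. By
    Frobenius the same holds for the powers x_i^(Q^k), and filtering by monomials
    bounds the length of R/(x_1^(Q^k), ..., x_d^(Q^k)) by (Q^d - 1)^k times a
    constant. On the other hand R/m^n has length at least c n^d with c > 0, by
    induction along a chain of primes, using the Artin-Rees lemma.
    To compare the Cech cohomology of different families, forget one member v at
    a time: v acts bijectively on the kernel of that restriction, whereas every
    cocycle is killed by a power of each member of the family, hence of v if v
    is nilpotent modulo them. *)

Require Import Defs.
From HB Require Import structures.
From mathcomp Require Import all_boot all_order all_algebra.
From mathcomp Require Import boolp classical_sets.
From mathcomp Require Import zify ring.

Set Implicit Arguments.
Unset Strict Implicit.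
Unset Printing Implicit Defensive.

Import GRing.Theory.
Local Open Scope ring_scope.
Local Open Scope classical_set_scope.

(** * Ideals in a Noetherian ring *)

(** The contradiction in (i) => (ii) is one of growth: a vanishing class saves a single monomial out
    of Q^d, and iterating Frobenius turns this into exponentials with bases Q^d - 1 and Q^d. A lower
    bound of the right order for the length of R/m^n is therefore enough, and Hilbert-Samuel
    polynomials are bypassed. Quotients R/I and R/P are not formed: their ideals are the ideals of R
    above I or P, and lengths are lengths of chains of ideals between two given ones. Frobenius is
    not R-linear on A, so it gives no map via [cech_H_map]; the vanishing of a top class is first
    translated into membership in (x_1^n, ..., x_d^n)A, where powers of elements can be taken.
    Families have to be compared because H^d_m is computed from chosen generators of m, while a
    paraclass is given on the parameters; both are reached from the joint family. The comparison is
    phrased with cocycles, as one injectivity and one lifting statement for each restriction. *)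

Section IdealTheory.
Variable R : comNzRingType.
Implicit Types (I J K L P : set R) (a b r : R) (s : seq R).

Lemma ideal0 I : is_ideal I -> I 0. Proof. by case. Qed.

Lemma idealD I a b : is_ideal I -> I a -> I b -> I (a + b).
Proof. by case=> _ + _; apply. Qed.

Lemma idealM I r a : is_ideal I -> I a -> I (r * a).
Proof. by case=> _ _; apply. Qed.

Lemma idealMR I r a : is_ideal I -> I a -> I (a * r).
Proof. by rewrite mulrC; apply: idealM. Qed.

Lemma idealN I a : is_ideal I -> I a -> I (- a).
Proof. by move=> iI Ia; rewrite -mulN1r; apply: idealM. Qed.

Lemma idealB I a b : is_ideal I -> I a -> I b -> I (a - b).
Proof. by move=> iI Ia Ib; apply: idealD => //; apply: idealN. Qed.

Lemma ideal_sum I (T : Type) (t : seq T) (Q : pred T) (F : T -> R) :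
  is_ideal I -> (forall i, Q i -> I (F i)) -> I (\sum_(i <- t | Q i) F i).
Proof.
by move=> iI IF; apply: big_ind => //; [exact: ideal0 | move=> *; exact: idealD].
Qed.

Lemma ideal_1 I : is_ideal I -> I 1 -> forall a, I a.
Proof. by move=> iI I1 a; rewrite -[a]mulr1; apply: idealM. Qed.

Lemma setI_ideal I J : is_ideal I -> is_ideal J -> is_ideal (I `&` J).
Proof.
move=> iI iJ; split=> [|a b [? ?] [? ?]|r a [? ?]].
- by split; apply: ideal0.
- by split; apply: idealD.
- by split; apply: idealM.
Qed.

Definition ideal_gen (S : set R) : set R :=
  [set a | forall J, is_ideal J -> S `<=` J -> J a].

Lemma ideal_gen_ideal S : is_ideal (ideal_gen S).
Proof.
split=> [J iJ _|a b Ga Gb J iJ SJ|r a Ga J iJ SJ].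
- exact: ideal0.
- by apply: idealD => //; [apply: Ga | apply: Gb].
- by apply: idealM => //; apply: Ga.
Qed.

Lemma sub_ideal_gen S : S `<=` ideal_gen S.
Proof. by move=> a Sa J _; apply. Qed.

Lemma ideal_gen_sub S J : is_ideal J -> S `<=` J -> ideal_gen S `<=` J.
Proof. by move=> iJ SJ a; apply. Qed.

Lemma ideal_genS S S' : S `<=` S' -> ideal_gen S `<=` ideal_gen S'.
Proof.
move=> SS'; apply: ideal_gen_sub; first exact: ideal_gen_ideal.
exact: subset_trans SS' (@sub_ideal_gen _).
Qed.

Definition ideal_add I J : set R := [set a | exists b c, [/\ I b, J c & a = b + c]].

Lemma ideal_add_ideal I J : is_ideal I -> is_ideal J -> is_ideal (ideal_add I J).
Proof.
move=> iI iJ; split.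
- by exists 0, 0; split; [exact: ideal0 | exact: ideal0 | rewrite addr0].
- move=> _ _ [b [c [Ib Jc ->]]] [b' [c' [Ib' Jc' ->]]].
  by exists (b + b'), (c + c'); split; [exact: idealD | exact: idealD | rewrite addrACA].
- move=> r _ [b [c [Ib Jc ->]]].
  by exists (r * b), (r * c); split; [exact: idealM | exact: idealM | rewrite mulrDr].
Qed.

Lemma ideal_addl I J : is_ideal J -> I `<=` ideal_add I J.
Proof. by move=> iJ a Ia; exists a, 0; split=> //; [exact: ideal0 | rewrite addr0]. Qed.

Lemma ideal_addr I J : is_ideal I -> J `<=` ideal_add I J.
Proof. by move=> iI a Ja; exists 0, a; split=> //; [exact: ideal0 | rewrite add0r]. Qed.

Lemma ideal_add_sub I J K : is_ideal K -> I `<=` K -> J `<=` K -> ideal_add I J `<=` K.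
Proof. by move=> iK IK JK _ [b [c [Ib Jc ->]]]; apply: idealD; [|apply: IK|apply: JK]. Qed.

Definition multiples r : set R := [set a | exists c, a = c * r].

Lemma multiples_ideal r : is_ideal (multiples r).
Proof.
split; first by exists 0; rewrite mul0r.
- by move=> _ _ [c ->] [c' ->]; exists (c + c'); rewrite mulrDl.
- by move=> r' _ [c ->]; exists (r' * c); rewrite mulrA.
Qed.

Lemma multiples_id r : multiples r r. Proof. by exists 1; rewrite mul1r. Qed.

Lemma multiples_sub r K : is_ideal K -> K r -> multiples r `<=` K.
Proof. by move=> iK Kr _ [c ->]; apply: idealM. Qed.

Definition colon I r : set R := [set a | I (a * r)].

Lemma colon_ideal I r : is_ideal I -> is_ideal (colon I r).
Proof.
move=> iI; split; rewrite /colon /=.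
- by rewrite mul0r; apply: ideal0.
- by move=> a b Ia Ib; rewrite mulrDl; apply: idealD.
- by move=> a b Ib; rewrite -mulrA; apply: idealM.
Qed.

Lemma ideal_span_ideal s : is_ideal (ideal_span s).
Proof.
split.
- by exists (fun=> 0); rewrite big1 // => i _; rewrite mul0r.
- move=> _ _ [c ->] [c' ->]; exists (fun i => c i + c' i).
  by rewrite -big_split; apply: eq_bigr => i _; rewrite mulrDl.
- move=> r _ [c ->]; exists (fun i => r * c i).
  by rewrite mulr_sumr; apply: eq_bigr => i _; rewrite mulrA.
Qed.

Lemma ideal_span_mem s r : r \in s -> ideal_span s r.
Proof.
move=> sr; exists (fun i => (i == index r s :> nat)%:R).
have lt : (index r s < size s)%N by rewrite index_mem.
rewrite (bigD1 (Ordinal lt)) //= eqxx mul1r nth_index // big1 ?addr0 // => i.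
by rewrite -val_eqE /= => /negPf ->; rewrite mul0r.
Qed.

Lemma ideal_span_sub s J : is_ideal J -> (forall r, r \in s -> J r) ->
  ideal_span s `<=` J.
Proof.
move=> iJ sJ _ [c ->]; apply: ideal_sum => // i _.
by apply: idealM => //; apply: sJ; apply: mem_nth.
Qed.

Lemma prime_ideal_ideal P : prime_ideal P -> is_ideal P. Proof. by case. Qed.

(** * Powers of an ideal *)

Definition ideal_mul I J : set R :=
  ideal_gen [set r | exists a b, [/\ I a, J b & r = a * b]].

Fixpoint ideal_pow I n : set R :=
  if n is n'.+1 then ideal_mul I (ideal_pow I n') else [set: R].

Lemma ideal_pow_ideal I n : is_ideal (ideal_pow I n).
Proof. by case: n => [|n] //=; apply: ideal_gen_ideal. Qed.

Lemma ideal_powS I n a b : I a -> ideal_pow I n b -> ideal_pow I n.+1 (a * b).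
Proof. by move=> Ia Ib; apply: sub_ideal_gen; exists a, b. Qed.

Lemma ideal_powM I i j a b :
  ideal_pow I i a -> ideal_pow I j b -> ideal_pow I (i + j) (a * b).
Proof.
elim: i a => [|i IH] a Ia Ib; first by apply: idealM => //; exact: ideal_pow_ideal.
have := Ia (colon (ideal_pow I (i.+1 + j)) b); apply.
  exact/colon_ideal/ideal_pow_ideal.
move=> _ [u [v [Iu Iv ->]]]; rewrite /colon /= -mulrA.
by apply: ideal_powS => //; apply: IH.
Qed.

Lemma ideal_powX I n a : I a -> ideal_pow I n (a ^+ n).
Proof.
by move=> Ia; elim: n => [|n IH] //; rewrite exprS; apply: ideal_powS.
Qed.

Lemma ideal_pow_sub I i j : (i <= j)%N -> ideal_pow I j `<=` ideal_pow I i.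
Proof.
move=> le_ij; rewrite -(subnK le_ij); elim: (j - i)%N => [//|k IH].
apply: subset_trans IH; rewrite addSn.
apply: ideal_gen_sub; first exact: ideal_pow_ideal.
by move=> _ [a [b [Ia Ib ->]]]; apply: idealM => //; exact: ideal_pow_ideal.
Qed.

Lemma ideal_pow1 I n : is_ideal I -> (0 < n)%N -> ideal_pow I n `<=` I.
Proof.
case: n => // n iI _; apply: ideal_gen_sub => // _ [a [b [Ia _ ->]]].
exact: idealMR.
Qed.

(** * Noetherian induction, products of primes, maximal ideals *)

Hypothesis noethR : noetherian R.

(** A failure yields, by dependent choice, a strictly ascending chain of ideals; the finitely many
    generators of its union all lie in one member, where the chain must stop. *)
Lemma noetherian_ind (Q : set R -> Prop) :
  (forall I, is_ideal I ->
    (forall J, is_ideal J -> I `<` J -> Q J) -> Q I) ->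
  forall I, is_ideal I -> Q I.
Proof.
move=> step I0 iI0; apply: contrapT => nQ0.
pose T := {I | is_ideal I /\ ~ Q I}.
have next (x : T) : {y : T | sval x `<` sval y}.
  apply: cid; case: x => I [iI nQ] /=; apply: contrapT => nex; apply: nQ.
  apply: step => // J iJ IJ; apply: contrapT => nQJ; apply: nex.
  by exists (exist _ J (conj iJ nQJ)).
pose f := fix f n : T :=
  if n is n'.+1 then sval (next (f n')) else exist _ I0 (conj iI0 nQ0).
have fS n : sval (f n) `<` sval (f n.+1) by exact: (svalP (next (f n))).
have fle i j : (i <= j)%N -> sval (f i) `<=` sval (f j).
  move=> le_ij; rewrite -(subnK le_ij); elim: (j - i)%N => [//|k IH].
  by apply: subset_trans IH _; rewrite addSn; apply: properW; apply: fS.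
pose U : set R := [set a | exists n, sval (f n) a].
have fi n : is_ideal (sval (f n)) by case: (svalP (f n)).
have iU : is_ideal U.
  split; first by exists 0%N; apply: ideal0.
  - move=> a b [i fa] [j fb]; exists (maxn i j); apply: idealD => //.
      exact: (fle i _ (leq_maxl i j)).
    exact: (fle j _ (leq_maxr i j)).
  - by move=> r a [i fa]; exists i; apply: idealM.
have [s sU] := noethR iU.
have [n fn] : exists n, forall r, r \in s -> sval (f n) r.
  have : forall r, r \in s -> U r by move=> r rs; rewrite -sU; apply: ideal_span_mem.
  elim: (s) => [|r t IH] tU; first by exists 0%N.
  have [|n fn] := IH; first by move=> r' r't; apply: tU; rewrite inE r't orbT.
  have [k fk] := tU r (mem_head _ _); exists (maxn n k) => r'.
  rewrite inE => /predU1P[->|/fn]; first exact: (fle k _ (leq_maxr n k)).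
  exact: (fle n _ (leq_maxl n k)).
have [_] := fS n; apply=> a fa.
have : U a by exists n.+1.
by rewrite -sU; apply: ideal_span_sub.
Qed.

Lemma proper_add_multiples I r : is_ideal I -> ~ I r ->
  is_ideal (ideal_add I (multiples r)) /\ I `<` ideal_add I (multiples r).
Proof.
move=> iI nIr; have im := multiples_ideal r; split; first exact: ideal_add_ideal.
split; first exact: ideal_addl.
move=> sI; apply: nIr; apply: sI; apply: ideal_addr => //; exact: multiples_id.
Qed.

(** Stands in for the finiteness of the set of minimal primes: a prime above [I] contains one of the
    [Ps]. If [I] is proper and not prime, say it contains [a * b] but neither factor, the lists for
    I + (a) and I + (b) are concatenated. Choosing one element [c P] in each prime avoids products
    of ideals. *)
Lemma ideal_prime_product I : is_ideal I ->
  exists Ps : seq (set R),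
    (forall P, P \in Ps -> prime_ideal P /\ I `<=` P) /\
    forall c : set R -> R, (forall P : set R, P \in Ps -> P (c P)) ->
      I (\prod_(P <- Ps) c P).
Proof.
move: I; apply: noetherian_ind => I iI IH.
have [I1|nI1] := pselect (I 1).
  by exists [::]; split=> // c _; rewrite big_nil.
have [pI|npI] := pselect (forall a b, I (a * b) -> I a \/ I b).
  exists [:: I]; split; first by move=> P; rewrite mem_seq1 => /eqP ->; split.
  by move=> c Ic; rewrite big_seq1; apply: Ic; apply: mem_head.
have [a [b [Iab nIa nIb]]] : exists a b, [/\ I (a * b), ~ I a & ~ I b].
  apply: contrapT => nex; apply: npI => a b Iab.
  apply: contrapT => nor; apply: nex; exists a, b.
  by split=> // ?; apply: nor; tauto.
have [iIa pa] := proper_add_multiples iI nIa.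
have [iIb pb] := proper_add_multiples iI nIb.
have [Ps [Psp PsI]] := IH _ iIa pa; have [Qs [Qsp QsI]] := IH _ iIb pb.
exists (Ps ++ Qs); split.
  move=> P; rewrite mem_cat => /orP[/Psp[pP sP]|/Qsp[pP sP]]; split=> //.
    exact: subset_trans (properW pa) sP.
  exact: subset_trans (properW pb) sP.
move=> c cP; rewrite big_cat.
have [|u [_ [Iu [v ->] ->]]] := PsI c.
  by move=> P PPs; apply: cP; rewrite mem_cat PPs.
have [|u' [_ [Iu' [v' ->] ->]]] := QsI c.
  by move=> P PPs; apply: cP; rewrite mem_cat PPs orbT.
rewrite /= mulrDl; apply: idealD => //; first exact: idealMR.
rewrite mulrDr; apply: idealD => //; first exact: idealM.
by rewrite mulrACA; apply: idealM.
Qed.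

Lemma exists_maximal I : is_ideal I -> ~ I 1 ->
  exists J, maximal_ideal J /\ I `<=` J.
Proof.
move: I; apply: noetherian_ind => I iI IH nI1.
have [mI|nmI] := pselect (maximal_ideal I); first by exists I; split.
have [J [iJ nJ1 IJ]] : exists J, [/\ is_ideal J, ~ J 1 & I `<` J].
  apply: contrapT => nex; apply: nmI; split=> // J iJ nJ1 IJ.
  apply: contrapT => nJI; apply: nex; exists J; do 2!split=> //; move=> JI.
  by apply: nJI; apply/seteqP.
have [M [mM JM]] := IH J iJ IJ nJ1.
by exists M; split=> //; apply: subset_trans JM; apply: properW.
Qed.

Lemma maximal_prime I : maximal_ideal I -> prime_ideal I.
Proof.
move=> [iI nI1 Imax]; split=> // a b Iab; have [|nIa] := pselect (I a); first by left.
right; have [iJ pJ] := proper_add_multiples iI nIa.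
have [[u [_ [Iu [v ->] E]]]|nJ1] := pselect (ideal_add I (multiples a) 1).
  rewrite -[b]mul1r E mulrDl; apply: idealD => //; first exact: idealMR.
  by rewrite -mulrA; apply: idealM.
by case: pJ => pJ []; rewrite (Imax _ iJ nJ1 pJ).
Qed.

End IdealTheory.

(** * Systems of parameters *)

Section SystemOfParameters.
Variable R : comNzRingType.
Implicit Types (I J P Q : set R) (Qs : seq (set R)).

(** Primes of the tail contained in the head [Q] are discarded. If there are none, an [x] avoiding
    the tail but lying in [Q] is corrected by an element of [J] that lies in every prime of the tail
    and not in [Q]. *)
Lemma prime_avoidance J Qs : is_ideal J ->
    (forall Q, Q \in Qs -> prime_ideal Q /\ ~ J `<=` Q) ->
  exists2 x, J x & forall Q, Q \in Qs -> ~ Q x.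
Proof.
move=> iJ; have [n] := ubnP (size Qs); elim: n Qs => // n IH [_ _|Q Qs].
  by exists 0; first exact: ideal0.
rewrite /= ltnS => szQs pQs.
have [pQ nJQ] := pQs Q (mem_head _ _).
have [/hasP[P PQs /asboolP PQ]|/hasPn nsub] := boolP (has (fun P => `[< P `<=` Q >]) Qs).
  pose Qs' := Q :: [seq P <- Qs | ~~ `[< P `<=` Q >]].
  have [||x Jx xQs'] := IH Qs'.
  - apply: leq_trans szQs; rewrite /= ltnS size_filter ltn_neqAle.
    rewrite -all_count count_size andbT -has_predC.
    by apply/hasP; exists P => //=; rewrite negbK; apply/asboolP.
  - move=> P'; rewrite inE mem_filter => /predU1P[->|/andP[_ P'Qs]].
      exact: pQs (mem_head _ _).
    by apply: pQs; rewrite inE P'Qs orbT.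
  exists x => // P'; rewrite inE => /predU1P[->|P'Qs].
    exact: xQs' (mem_head _ _).
  have [P'Q|nP'Q] := pselect (P' `<=` Q).
    by move=> /P'Q; apply: xQs'; apply: mem_head.
  apply: xQs'; rewrite inE mem_filter P'Qs andbT; apply/orP; right.
  by apply/asboolP.
have [||x Jx xQs] := IH Qs => //.
  by move=> P PQs; apply: pQs; rewrite inE PQs orbT.
have [Qx|nQx] := pselect (Q x); last first.
  by exists x => // P; rewrite inE => /predU1P[->//|/xQs].
have notsub (A B : set R) : ~ A `<=` B -> exists2 a, A a & ~ B a.
  move=> nAB; apply: contrapT => nex; apply: nAB => a Aa.
  by apply: contrapT => nBa; apply: nex; exists a.
have [y [Jy nQy yQs]] : exists y, [/\ J y, ~ Q y & forall P, P \in Qs -> P y].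
  elim: (Qs) nsub pQs {szQs xQs} => [|P Ps IHP] nsub pQs.
    by have [y] := notsub _ _ nJQ; exists y; split.
  have [||y [Jy nQy yPs]] := IHP.
  - by move=> P' P'Ps; apply: nsub; rewrite inE P'Ps orbT.
  - move=> P'; rewrite inE => /predU1P[->|P'Ps]; apply: pQs.
      exact: mem_head.
    by rewrite !inE P'Ps !orbT.
  have [z Pz nQz] : exists2 z, P z & ~ Q z.
    by apply: notsub; apply/asboolPn; apply: nsub; apply: mem_head.
  have [pP _] : prime_ideal P /\ ~ J `<=` P.
    by apply: pQs; rewrite !inE eqxx orbT.
  exists (z * y); split; first exact: idealM.
    by case: pQ => _ _ PM /PM[].
  move=> P'; rewrite inE => /predU1P[->|P'Ps].
    exact: idealMR (prime_ideal_ideal pP) Pz.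
  have [pP' _] : prime_ideal P' /\ ~ J `<=` P'.
    by apply: pQs; rewrite !inE P'Ps !orbT.
  by apply: idealM; [apply: prime_ideal_ideal | apply: yPs].
exists (x + y); first exact: idealD.
move=> P; rewrite inE => /predU1P[->|PQs] xyP.
  apply: nQy; rewrite -[y](addKr x) addrC.
  by apply: idealB => //; apply: prime_ideal_ideal.
apply: (xQs P PQs); rewrite -[x](addrK y); apply: idealB => //; last exact: yQs.
by apply: prime_ideal_ideal; case: (pQs P); rewrite // inE PQs orbT.
Qed.

Lemma prime_prodN P Qs (c : set R -> R) : prime_ideal P ->
  (forall Q, Q \in Qs -> ~ P (c Q)) -> ~ P (\prod_(Q <- Qs) c Q).
Proof.
move=> [iP P1 PM]; elim: Qs => [|Q Qs IH] cP; first by rewrite big_nil.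
rewrite big_cons => /PM[|]; first by apply: cP; apply: mem_head.
by apply: IH => Q' Q'Qs; apply: cP; rewrite inE Q'Qs orbT.
Qed.

Variable m : set R.
Hypotheses (noethR : noetherian R) (localR : local_with_max m).

Lemma max_ideal_prime : prime_ideal m.
Proof. by case: localR => mm _; apply: maximal_prime. Qed.

Lemma max_ideal_ideal : is_ideal m.
Proof. exact: prime_ideal_ideal max_ideal_prime. Qed.

Lemma proper_sub_max I : is_ideal I -> ~ I 1 -> I `<=` m.
Proof.
move=> iI nI1; have [J [mJ IJ]] := exists_maximal noethR iI nI1.
by case: localR => _ /(_ J mJ) <-.
Qed.

Lemma prime_sub_max P : prime_ideal P -> P `<=` m.
Proof. by move=> pP; apply: proper_sub_max; case: pP. Qed.

(** This is dim R/I <= k read off in [R]; it holds vacuously when no prime contains [I]. *)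
Definition quotient_dim_le I k := forall n (P : 'I_n.+1 -> set R),
  (forall i, prime_ideal (P i) /\ I `<=` P i) ->
  (forall i j : 'I_n.+1, (i < j)%N -> P i `<` P j) -> (n <= k)%N.

(** [x] avoids the listed primes other than [m]. A chain of positive length above I + (x) starts at
    a prime different from [m]; the listed prime inside it does not contain [x], so the chain
    extends downwards by one. *)
Lemma quotient_dim_le_step I k : is_ideal I -> quotient_dim_le I k.+1 ->
  exists2 x, m x & quotient_dim_le (ideal_add I (multiples x)) k.
Proof.
move=> iI dimI; have [Ps [Psp PsI]] := ideal_prime_product noethR iI.
have im := max_ideal_ideal.
have [|x mx xPs] := @prime_avoidance m [seq P <- Ps | P != m] im.
  move=> P; rewrite mem_filter => /andP[/eqP Pm /Psp[pP _]]; split=> // mP.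
  by apply: Pm; apply/seteqP; split=> //; apply: prime_sub_max.
exists x => // n P Pp Plt; rewrite leqNgt; apply/negP => lt_kn.
have n_gt0 : (0 < n)%N by apply: leq_trans lt_kn.
have iPi i : is_ideal (P i) by case: (Pp i) => /prime_ideal_ideal.
have IP i : I `<=` P i.
  by case: (Pp i) => _; apply: subset_trans; apply/ideal_addl/multiples_ideal.
have Px i : P i x.
  by case: (Pp i) => _; apply; apply: ideal_addr => //; apply: multiples_id.
have [Q QPs QP0] : exists2 Q, Q \in Ps & Q `<=` P ord0.
  apply: contrapT => nex.
  have wit Q : exists a, Q \in Ps -> Q a /\ ~ P ord0 a.
    have [QPs|] := boolP (Q \in Ps); last by exists 0.
    apply: contrapT => nex'; apply: nex; exists Q => // a Qa.
    by apply: contrapT => nPa; apply: nex'; exists a.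
  have [c cP] := choice wit.
  have cQ Q : Q \in Ps -> Q (c Q) by move=> /cP[].
  have cN Q : Q \in Ps -> ~ P ord0 (c Q) by move=> /cP[].
  have [pP _] := Pp ord0.
  by apply: (prime_prodN pP cN); apply: IP; apply: PsI.
have QxN : Q != m -> ~ Q x by move=> Qm; apply: xPs; rewrite mem_filter Qm.
have P0m : P ord0 <> m.
  move=> P0m; have [_] := Plt ord0 ord_max n_gt0; rewrite P0m; apply.
  by apply: prime_sub_max; case: (Pp ord_max).
have [pQ IQ] := Psp Q QPs.
have Qm : Q != m.
  apply/eqP => Qm; apply: P0m; apply/seteqP; split; last by rewrite -Qm.
  by apply: prime_sub_max; case: (Pp ord0).
have QltP i : Q `<` P i.
  have QP : Q `<=` P i.
    apply: subset_trans QP0 _; have [->//|i0] := eqVneq i ord0.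
    by apply: properW; apply: Plt; rewrite /= lt0n.
  by split=> // PQ; apply: (QxN Qm); apply: PQ.
pose P' (i : 'I_n.+2) := if unlift ord0 i is Some j then P j else Q.
suff : (n.+1 <= k.+1)%N by rewrite ltnS leqNgt lt_kn.
apply: (dimI n.+1 P').
- move=> i; rewrite /P'; case: (unlift ord0 i) => [j|] //.
  by split; last exact: IP; case: (Pp j).
- move=> i j; rewrite /P'; case: (unliftP ord0 i) => [i' ->|->];
    case: (unliftP ord0 j) => [j' ->|->] //=.
  by rewrite /bump !add1n ltnS; apply: Plt.
Qed.

Lemma exists_parameters d : krull_dim R d -> exists x : d.-tuple R, parameters m x.
Proof.
move=> [_ dimR].
have [s [szs sm dims]] : exists s : seq R, [/\ size s = d, {in s, forall a, m a} &
    quotient_dim_le (ideal_gen [set` s]) 0].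
  have dim0 : exists s : seq R, [/\ size s = 0%N, {in s, forall a, m a} &
      quotient_dim_le (ideal_gen [set` s]) d].
    exists [::]; split=> // n P Pp Plt; apply: dimR; exists P; split=> // i.
    by case: (Pp i).
  suff H k : (k <= d)%N -> exists s : seq R, [/\ size s = k, {in s, forall a, m a} &
      quotient_dim_le (ideal_gen [set` s]) (d - k)].
    by have := H d (leqnn _); rewrite subnn.
  elim: k => [_|k IH lt_kd]; first by rewrite subn0.
  have [s [szs sm]] := IH (ltnW lt_kd); rewrite -(subnSK lt_kd).
  move=> /(quotient_dim_le_step (ideal_gen_ideal _))[x mx dimx].
  exists (x :: s); split=> [|a|n P Pp]; first by rewrite /= szs.
    by rewrite inE => /predU1P[->//|/sm].
  apply: dimx => i; have [pP sP] := Pp i; split=> //.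
  have iP := prime_ideal_ideal pP.
  apply: ideal_add_sub => //.
    apply: subset_trans sP; apply: ideal_genS => a /= sa.
    by rewrite inE sa orbT.
  apply: multiples_sub => //; apply: sP; apply: sub_ideal_gen => /=.
  exact: mem_head.
have szs' : size s == d by apply/eqP.
exists (Tuple szs'); apply/seteqP; split=> P [pP sP]; split=> //; last first.
  by move=> a /= /sm/sP.
have iP := prime_ideal_ideal pP; have Pm := prime_sub_max pP.
move=> a ma; apply: contrapT => nPa.
(* A prime [P] above [s] that misses [a] forms with [m] a chain of length one, in dimension zero. *)
suff : (1 <= 0)%N by [].
apply: (dims 1%N (fun i => if i == ord0 then P else m)).
- move=> i; case: eqP => _; split=> //; first exact: ideal_gen_sub.
    exact: max_ideal_prime.
  by apply: ideal_gen_sub; first exact: max_ideal_ideal.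
- move=> [[|[|//]] ?] [[|[|//]] ?] //= _; split=> // mP.
  by apply: nPa; apply: mP.
Qed.

(** All primes in a prime product for [I] equal [m], so [u] can serve as every factor. *)
Lemma zero_locus_nilpotent I u : is_ideal I ->
  (forall P, prime_ideal P -> I `<=` P -> P = m) -> m u -> exists n, I (u ^+ n).
Proof.
move=> iI Im mu; have [Ps [Psp PsI]] := ideal_prime_product noethR iI.
exists (size Ps); rewrite -iter_mulr_1 -[size Ps](count_predT Ps) -big_const_seq.
by apply: PsI => P /Psp[pP /(Im _ pP) ->].
Qed.

End SystemOfParameters.

(** * The Hilbert basis theorem *)

Section HilbertBasis.
Variable R : comNzRingType.
Hypothesis noethR : noetherian R.
Variable I : set {poly R}.
Hypothesis iI : is_ideal I.

Definition lead_ideal n : set R :=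
  [set a | exists f, [/\ I f, (size f <= n.+1)%N & f`_n = a]].

Lemma lead_ideal_ideal n : is_ideal (lead_ideal n).
Proof.
split.
- by exists 0; rewrite size_poly0 coef0; split=> //; apply: ideal0.
- move=> _ _ [f [If szf <-]] [g [Ig szg <-]]; exists (f + g); split.
  + exact: idealD.
  + by rewrite (leq_trans (size_polyD _ _)) // geq_max szf.
  + by rewrite coefD.
- move=> r _ [f [If szf <-]]; exists (r%:P * f); split; first exact: idealM.
    by rewrite mul_polyC (leq_trans (size_scale_leq _ _)).
  by rewrite coefCM.
Qed.

Lemma lead_ideal_sub i j : (i <= j)%N -> lead_ideal i `<=` lead_ideal j.
Proof.
move=> le_ij; rewrite -(subnK le_ij); elim: (j - i)%N => [//|k IH].
apply: subset_trans IH _ => _ [f [If szf <-]]; exists ('X * f).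
split; first exact: idealM; last by rewrite coefXM.
apply: leq_trans (size_polyMleq _ _) _; rewrite size_polyX /=.
by rewrite addSn.
Qed.

Lemma lead_ideal_stable : exists n, forall k, lead_ideal k `<=` lead_ideal n.
Proof.
have [s sU] : exists s, ideal_span s = [set a | exists n, lead_ideal n a].
  apply: noethR; split; first by exists 0%N; exact: (ideal0 (lead_ideal_ideal 0)).
  - move=> a b [i La] [j Lb]; exists (maxn i j); apply: idealD.
    + exact: lead_ideal_ideal.
    + exact: (lead_ideal_sub (leq_maxl i j)) La.
    + exact: (lead_ideal_sub (leq_maxr i j)) Lb.
  - by move=> r a [i La]; exists i; apply: idealM => //; apply: lead_ideal_ideal.
have [n sn] : exists n, forall a, a \in s -> lead_ideal n a.
  have : forall a, a \in s -> exists n, lead_ideal n a.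
    move=> a /ideal_span_mem; rewrite sU; exact.
  elim: (s) => [|a t IH] tU; first by exists 0%N.
  have [|n tn] := IH; first by move=> b bt; apply: tU; rewrite inE bt orbT.
  have [k ak] := tU a (mem_head _ _); exists (maxn n k) => b.
  rewrite inE => /predU1P[->|/tn]; first exact: (lead_ideal_sub (leq_maxr n k)).
  exact: (lead_ideal_sub (leq_maxl n k)).
exists n => k a ka; have : ideal_span s a by rewrite sU; exists k.
by apply: ideal_span_sub => //; apply: lead_ideal_ideal.
Qed.

(** Lifts of generators of [lead_ideal n] cancel the coefficient of degree [n]; what remains has
    smaller degree. *)
Lemma bounded_degree_fg n : exists s : seq {poly R}, (forall f, f \in s -> I f) /\
  forall f, I f -> (size f <= n)%N -> ideal_span s f.
Proof.
elim: n => [|n [s [sI Is]]].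
  exists [::]; split=> // f _; rewrite leqn0 size_poly_eq0 => /eqP ->.
  exact: (ideal0 (ideal_span_ideal _)).
have [t tL] := noethR (lead_ideal_ideal n).
have [w wP] : exists w : R -> {poly R}, forall a, lead_ideal n a ->
    [/\ I (w a), (size (w a) <= n.+1)%N & (w a)`_n = a].
  suff /choice[w] : forall a, exists f, lead_ideal n a ->
      [/\ I f, (size f <= n.+1)%N & f`_n = a] by exists w.
  move=> a; have [[f fa]|na] := pselect (lead_ideal n a); first by exists f.
  by exists 0.
have tw a : a \in t -> [/\ I (w a), (size (w a) <= n.+1)%N & (w a)`_n = a].
  by move=> /ideal_span_mem; rewrite tL => /wP.
exists (map w t ++ s); split.
  move=> f; rewrite mem_cat => /orP[/mapP[a /tw[Iwa _ _] ->]//|]; exact: sI.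
move=> f If szf; have ispan := ideal_span_ideal (map w t ++ s).
have : ideal_span t f`_n by rewrite tL; exists f.
move=> [c fn]; pose g := \sum_(i < size t) (c i)%:P * w t`_i.
have tin (i : 'I_(size t)) : t`_i \in t by apply: mem_nth.
have gspan : ideal_span (map w t ++ s) g.
  apply: ideal_sum => // i _; apply: idealM => //; apply: ideal_span_mem.
  by rewrite mem_cat map_f.
have Ig : I g.
  by apply: ideal_sum => // i _; apply: idealM => //; case: (tw _ (tin i)).
rewrite -[f](subrK g); apply: idealD => //.
have : ideal_span s (f - g).
  apply: Is; first exact: idealB.
  apply/leq_sizeP => j; rewrite leq_eqVlt coefB => /predU1P[<-|lt_nj].
    rewrite fn coef_sum; apply/eqP; rewrite subr_eq0; apply/eqP/eq_bigr => i _.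
    by rewrite coefCM; case: (tw _ (tin i)) => _ _ ->.
  rewrite coef_sum (leq_sizeP _ _ szf) // big1 ?subr0 // => i _.
  by rewrite coefCM; case: (tw _ (tin i)) => _ /leq_sizeP w0 _; rewrite w0 ?mulr0.
apply: ideal_span_sub => // h hs; apply: ideal_span_mem.
by rewrite mem_cat hs orbT.
Qed.

(** Beyond the degree where the leading ideals are stable, a power of 'X times a member of degree at
    most [n] cancels the leading term, so the degree drops until the bounded case applies. *)
Lemma hilbert_basis_ideal : exists s : seq {poly R}, ideal_span s = I.
Proof.
have [n nP] := lead_ideal_stable; have [s [sI Is]] := bounded_degree_fg n.+1.
have ispan := ideal_span_ideal s.
exists s; apply/seteqP; split; first exact: ideal_span_sub.
move=> f; have [k] := ubnP (size f); elim: k f => // k IH f szf If.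
have [le_fn|lt_nf] := leqP (size f) n.+1; first exact: Is.
have [g [Ig szg gn]] : lead_ideal n (lead_coef f).
  apply: (nP (size f).-1); exists f; split=> //; first by rewrite leqSpred.
pose h := 'X^((size f).-1 - n) * g.
have szf_gt0 : (0 < size f)%N by apply: leq_ltn_trans lt_nf.
have Ih : I h by apply: idealM.
rewrite -[f](subrK h); apply: idealD => //; last by apply: idealM => //; apply: Is.
apply: IH; last exact: idealB.
apply: leq_trans (szf : (size f <= k)%N).
rewrite -[X in (_ < X)%N](prednK szf_gt0) ltnS.
apply/leq_sizeP => j; rewrite leq_eqVlt coefB coefXnM => /predU1P[<-|lt_fj].
  by rewrite ltnNge leq_subr /= subKn ?gn ?subrr // -ltnS prednK // ltnW.
rewrite ltnNge (leq_trans (leq_subr _ _) (ltnW lt_fj)) /=.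
have -> : f`_j = 0 by apply: nth_default; rewrite -(prednK szf_gt0).
have -> : g`_(j - ((size f).-1 - n)) = 0.
  by apply: nth_default; apply: leq_trans szg _; lia.
by rewrite subrr.
Qed.

End HilbertBasis.

Lemma hilbert_basis (R : comNzRingType) : noetherian R -> noetherian {poly R}.
Proof. by move=> noethR I; apply: hilbert_basis_ideal. Qed.

(** * The Rees algebra and the Artin-Rees lemma *)

Section ReesAlgebra.
Variable R : comNzRingType.
Implicit Types (I P : set R) (s : seq R).

(* The Rees algebra [R[It]] as a subset of [R[t]]. *)
Definition rees I : set {poly R} := [set f | forall n, ideal_pow I n f`_n].

Lemma rees_sum I n (F : 'I_n -> {poly R}) :
  (forall i, rees I (F i)) -> rees I (\sum_i F i).
Proof.
move=> FI k; rewrite coef_sum; apply: ideal_sum; first exact: ideal_pow_ideal.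
by move=> i _; apply: FI.
Qed.

Lemma reesM I f g : rees I f -> rees I g -> rees I (f * g).
Proof.
move=> If Ig k; rewrite coefM; apply: ideal_sum; first exact: ideal_pow_ideal.
by move=> i _; rewrite -[in ideal_pow I k](subnKC (leq_ord i)); apply: ideal_powM.
Qed.

Lemma reesC I r : rees I r%:P.
Proof.
by case=> [//|n]; rewrite coefC; apply: ideal0; apply: ideal_pow_ideal.
Qed.

Lemma rees_gen I a : I a -> rees I (a%:P * 'X).
Proof.
move=> Ia n; rewrite coefCM coefX; have [->|_] := eqVneq.
  by apply: ideal_powS.
by rewrite mulr0; apply: ideal0; apply: ideal_pow_ideal.
Qed.

Lemma reesX I f n : rees I f -> rees I (f ^+ n).
Proof.
move=> If; elim: n => [|n IH]; first by rewrite expr0; apply: reesC.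
by rewrite exprS; apply: reesM.
Qed.

Hypothesis noethR : noetherian R.

(** Finite generation of ideals is needed only upstairs, so the Rees algebra is not built as a ring:
    [B] is an iterated polynomial ring over [R], with one variable for each [a] in [s], sent to
    [a t]. *)
Lemma rees_noetherian_cover I s : (forall a, a \in s -> I a) ->
  exists (B : comNzRingType) (h : {rmorphism B -> {poly R}}),
    [/\ noetherian B, forall b, rees I (h b), forall r, exists b, h b = r%:P &
        forall a, a \in s -> exists b, h b = a%:P * 'X].
Proof.
elim: s => [|a s IH] sI.
  exists R, (polyC : {rmorphism R -> {poly R}}); split=> //; first exact: reesC.
  by move=> r; exists r.
have [|B [h [noethB hI hC hs]]] := IH.
  by move=> b bs; apply: sI; rewrite inE bs orbT.
pose h' := horner_morph (fun b => mulrC (a%:P * 'X) (h b)).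
exists {poly B}, h'; split; first exact: hilbert_basis.
- move=> f; suff : rees I (map_poly h f).[a%:P * 'X] by [].
  rewrite horner_coef; apply: rees_sum => i.
  rewrite coef_map; apply: reesM; first exact: hI.
  by apply/reesX/rees_gen/sI/mem_head.
- by move=> r; have [b hb] := hC r; exists b%:P; rewrite -hb; exact: horner_morphC.
- move=> b; rewrite inE => /predU1P[->|/hs[c hc]].
    by exists 'X; exact: horner_morphX.
  by exists c%:P; rewrite -hc; exact: horner_morphC.
Qed.

Lemma rees_cover_pow I s (B : comNzRingType) (h : {rmorphism B -> {poly R}}) n b :
    ideal_span s = I -> (forall r, exists b, h b = r%:P) ->
    (forall a, a \in s -> exists b, h b = a%:P * 'X) ->
  ideal_pow I n b -> exists f, h f = b%:P * 'X^n.
Proof.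
move=> sI hC hs; pose T k : set R := [set r | exists f, h f = r%:P * 'X^k].
have iT k : is_ideal (T k).
  split.
  - by exists 0; rewrite raddf0 polyC0 mul0r.
  - by move=> r r' [f hf] [f' hf']; exists (f + f'); rewrite rmorphD hf hf' polyCD mulrDl.
  - move=> r r' [f hf]; have [c hc] := hC r; exists (c * f).
    by rewrite rmorphM hf hc polyCM mulrA.
have IT1 : I `<=` T 1%N.
  rewrite -sI; apply: ideal_span_sub; first exact: iT.
  move=> a /hs[c hc].
  by exists c; rewrite hc expr1.
elim: n b => [|n IH] b Ib; first by have [c hc] := hC b; exists c; rewrite hc mulr1.
apply: (Ib (T n.+1)) => // _ [u [v [/IT1[f hf] /IH[g hg] ->]]].
by exists (f * g); rewrite rmorphM hf hg polyCM expr1 exprS mulrACA.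
Qed.

(* The Artin-Rees lemma for a principal ideal [xR] of the domain [R/P]. *)
Lemma artin_rees_colon I P x : is_ideal I -> prime_ideal P -> ~ P x ->
  exists c, forall n u, ideal_add (ideal_pow I (n + c)) P (x * u) ->
    ideal_add (ideal_pow I n) P u.
Proof.
move=> iI pP nPx; have [iP P1 PM] := pP; have [s sI] := noethR iI.
have sI' a : a \in s -> I a by rewrite -sI; apply: ideal_span_mem.
have [B [h [noethB hI hC hs]]] := rees_noetherian_cover sI'.
pose J := ideal_add (multiples x) P.
have iJ : is_ideal J by apply: ideal_add_ideal => //; apply: multiples_ideal.
have [t tE] : exists t, ideal_span t = [set f | forall n, J (h f)`_n].
  apply: noethB; split=> [n|f g Jf Jg n|f g Jg n].
  - by rewrite raddf0 coef0; apply: ideal0.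
  - by rewrite rmorphD coefD; apply: idealD.
  - rewrite rmorphM coefM; apply: ideal_sum => // i _; exact: idealM.
(* [w] is a chosen division by [x] modulo [P]. The value at 0 is fixed so that vanishing
   coefficients contribute nothing to [z] below. *)
have [w w0 wJ] : exists2 w : R -> R, w 0 = 0 & forall v, J v -> P (v - w v * x).
  suff /choice[w wP] : forall v, exists y, (v = 0 -> y = 0) /\ (J v -> P (v - y * x)).
    by exists w => [|v]; [apply: (wP 0).1 | apply: (wP v).2].
  move=> v; have [->|/eqP v0] := eqVneq v 0.
    by exists 0; split=> // _; rewrite mul0r subr0; apply: ideal0.
  have [[_ [p [[y ->] Pp vE]]]|nJ] := pselect (J v); last by exists 0.
  by exists y; split=> [/v0 []|_]; rewrite vE addrC addKr.
(* The Artin-Rees constant bounds the degrees of the generators of the ideal of those [f] whose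
   image has all coefficients in (x) + P. *)
pose c := \max_(f <- t) size (h f).
exists c => n u [b [p [Ib Pp xu]]].
have [F hF] := rees_cover_pow sI hC hs Ib.
have : ideal_span t F.
  rewrite tE => k; rewrite hF coefCM coefXn; case: eqP => _; last first.
    by rewrite mulr0; apply: ideal0.
  have -> : b = u * x - p by rewrite mulrC xu addrK.
  rewrite mulr1; apply: idealB => //; last by apply: ideal_addr => //; exact: multiples_ideal.
  by apply: ideal_addl => //; exists u.
case=> g Fg.
(* The coefficient of degree [n + c] of the image of [F], with the coefficients of the generators
   divided by [x]. For [i < n] the index [n + c - i] exceeds the degree of the generator; for
   [i >= n] the other factor lies in I^n. *)
pose z := \sum_(j < size t) \sum_(i < (n + c).+1) (h (g j))`_i * w (h t`_j)`_(n + c - i).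
have Iz : ideal_pow I n z.
  have ipow := ideal_pow_ideal I n.
  apply: ideal_sum => // j _; apply: ideal_sum => // i _.
  have [le_ni|lt_in] := leqP n i.
    by apply: idealMR => //; apply: (ideal_pow_sub le_ni); apply: hI.
  rewrite [X in w X]nth_default ?w0 ?mulr0; first exact: ideal0.
  apply: (@leq_trans c); last by have := ltn_ord i; lia.
  exact: (@leq_bigmax_seq _ _ xpredT (fun f => size (h f)) _ (mem_nth 0 (ltn_ord j))).
have bz : P (b - z * x).
  have -> : b = (h F)`_(n + c) by rewrite hF coefCM coefXn eqxx mulr1.
  rewrite Fg raddf_sum coef_sum /z mulr_suml -sumrB; apply: ideal_sum => // j _.
  rewrite /= rmorphM coefM mulr_suml -sumrB; apply: ideal_sum => // i _.
  rewrite -mulrA -mulrBr; apply: idealM => //; apply: wJ.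
  have : ideal_span t t`_j by apply: ideal_span_mem; apply: mem_nth.
  by rewrite tE; apply.
exists z, (u - z); split=> //; last by rewrite addrC subrK.
have [//|//] : P x \/ P (u - z).
apply: PM; have -> : x * (u - z) = (b - z * x) + p by rewrite mulrBr xu; ring.
exact: idealD.
Qed.

End ReesAlgebra.

(** * Lengths *)

Section Length.
Variable R : comNzRingType.
Implicit Types (I J K L P : set R) (r x y : R).

(** Chains with [n] strict steps from [I] to an ideal inside [J]. Comparing with bounds, instead of
    taking the length of J/I as a number, leaves room for infinite length. *)
Fixpoint length_ge I J n : Prop :=
  if n is n'.+1 then exists I', [/\ is_ideal I', I `<` I' & length_ge I' J n']
  else I `<=` J.

Definition length_le I J n := forall k, length_ge I J k -> (k <= n)%N.

Lemma sub_proper I J K : I `<=` J -> J `<` K -> I `<` K.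
Proof.
move=> IJ [JK nKJ]; split; first exact: subset_trans JK.
by move=> KI; apply: nKJ; apply: subset_trans IJ.
Qed.

Lemma length_ge_sub I J n : length_ge I J n -> I `<=` J.
Proof.
elim: n I => //= n IH I [I' [_ [II' _] /IH]]; exact: subset_trans.
Qed.

Lemma length_geS I I' J n : I `<=` I' -> length_ge I' J n -> length_ge I J n.
Proof.
case: n => [|n] /= II'; first exact: subset_trans.
by move=> [K [iK I'K KJ]]; exists K; split=> //; apply: sub_proper I'K.
Qed.

Lemma length_ge_subr I J J' n : J `<=` J' -> length_ge I J n -> length_ge I J' n.
Proof.
move=> JJ'; elim: n I => [|n IH] I /=; first by move=> /subset_trans; apply.
by move=> [K [iK IK /IH KJ']]; exists K.
Qed.

Lemma length_ge_leq I J n k : (k <= n)%N -> length_ge I J n -> length_ge I J k.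
Proof.
elim: n k I => [|n IH] [|k] I //=; first by move=> _ /(@length_ge_sub _ _ n.+1).
by rewrite ltnS => le_kn [K [iK IK /(IH _ _ le_kn)]]; exists K.
Qed.

Lemma length_ge_trans I J K a b :
  length_ge I J a -> length_ge J K b -> length_ge I K (a + b).
Proof.
elim: a I => [|a IH] I /=; first exact: length_geS.
by move=> [I' [iI' II' /IH H]] /H; exists I'.
Qed.

Lemma length_le_sub I I' J J' n :
  I `<=` I' -> J' `<=` J -> length_le I J n -> length_le I' J' n.
Proof.
by move=> II' J'J H k /(length_geS II')/(length_ge_subr J'J)/H.
Qed.

(* At each step of a chain, the modular law makes one of the two chains obtained
   by intersecting with [J] and by adding [J] grow. *)
Lemma length_ge_split J K : is_ideal J -> J `<=` K -> is_ideal K ->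
  forall n I, is_ideal I -> length_ge I K n ->
  exists a b, [/\ (n <= a + b)%N, length_ge (I `&` J) J a &
                  length_ge (ideal_add I J) K b].
Proof.
move=> iJ JK iK; elim=> [|n IH] I iI /=.
  by move=> IK; exists 0%N, 0%N; split=> //=; exact: ideal_add_sub.
move=> [I' [iI' [II' nI'I] /(IH _ iI')[a [b [le_n Ha Hb]]]]].
have [sub|nsub] := pselect (I' `&` J `<=` I).
  exists a, b.+1; split; first by rewrite addnS ltnS.
    by apply: length_geS Ha; apply: setSI.
  exists (ideal_add I' J); split=> //; first exact: ideal_add_ideal.
  split; first by move=> _ [u [v [/II' Iu Jv ->]]]; exists u, v.
  move=> sub'; apply: nI'I => u I'u.
  have [v [w [Iv Jw uvw]]] : ideal_add I J u by apply: sub'; apply: ideal_addl.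
  rewrite uvw; apply: idealD => //; apply: sub; split=> //.
  have -> : w = u - v by rewrite uvw addrC addKr.
  by apply: idealB => //; apply: II'.
exists a.+1, b; split=> //; last first.
  by apply: length_geS Hb => _ [u [v [/II' Iu Jv ->]]]; exists u, v.
exists (I' `&` J); split=> //; first exact: setI_ideal.
split; first exact: setSI.
by move=> sub; apply: nsub; apply: subset_trans sub _; apply: subIsetl.
Qed.

Lemma length_le_trans I J K a b : is_ideal I -> is_ideal J -> is_ideal K ->
  I `<=` J -> J `<=` K -> length_le I J a -> length_le J K b ->
  length_le I K (a + b).
Proof.
move=> iI iJ iK IJ JK Ha Hb n /(length_ge_split iJ JK iK iI)[u [v [le_n Hu Hv]]].
apply: leq_trans le_n _; apply: leq_add.
  by apply: Ha; apply: length_geS Hu => w Iw; split=> //; apply: IJ.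
by apply: Hb; apply: length_geS Hv; apply: ideal_addr.
Qed.

(** Multiplication by [r] identifies R/(I : r) with (I + (r))/I, and [K] lies in (I : r). A chain in
    the latter pulls back to its colon ideals by [r]; strictness survives because its members are
    generated by [I] and multiples of [r]. *)
Lemma length_le_colon K I r n : is_ideal I -> (forall a, K a -> I (a * r)) ->
  length_le K setT n -> length_le I (ideal_add I (multiples r)) n.
Proof.
move=> iI KI Kn k Ik; apply: Kn.
apply: (@length_geS _ (colon I r)) => //.
have : forall I1, I `<=` I1 -> is_ideal I1 ->
    length_ge I1 (ideal_add I (multiples r)) k -> length_ge (colon I1 r) setT k.
  elim: k {Ik} => [//|k IH] I1 II1 iI1 [I2 [iI2 [I12 nI21] Ik]] /=.
  exists (colon I2 r); split; first exact: colon_ideal.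
    split; first by move=> a; apply: I12.
    move=> sub; apply: nI21 => a I2a.
    have [u [_ [Iu [v ->] E]]] := length_ge_sub Ik I2a.
    rewrite E; apply: idealD => //; first exact: II1.
    apply: sub; rewrite /colon /=; have -> : v * r = a - u by rewrite E addrC addKr.
    by apply: idealB => //; apply/I12/II1.
  by apply: IH => //; apply: subset_trans I12.
by apply.
Qed.

Lemma length_le_filtration (f : nat -> set R) (g : nat -> nat) n :
  (forall i, is_ideal (f i)) -> (forall i, f i.+1 `<=` f i) ->
  (forall i, (i < n)%N -> length_le (f i.+1) (f i) (g i)) ->
  length_le (f n) (f 0%N) (\sum_(i < n) g i).
Proof.
move=> fi fS; elim: n => [_|n IH fg].
  by case=> // k [J [_ [_ nJ] /length_ge_sub]] /nJ.
rewrite big_ord_recr /= addnC; apply: (@length_le_trans _ (f n)) => //.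
- by elim: (n) => // k; apply: subset_trans.
- exact: fg.
- by apply: IH => i lt_in; apply: fg; apply: ltnW.
Qed.

(* Filter by the monomials [y^a r], [0 <= a_i <= q], in the variables [ys]: each
   of the (q+1)^|ys| quotients is a quotient of R/([full]). If the top monomial
   lies in [I], one of these quotients vanishes. *)
Lemma length_le_box (full : seq R) q n :
  length_le (ideal_gen [set` full]) setT n ->
  forall ys I r, is_ideal I ->
    (forall y, y \in full -> y \in ys \/ I (y * r)) ->
    (forall y, y \in ys -> I (y ^+ q.+1 * r)) ->
  length_le I (ideal_add I (multiples r)) (q.+1 ^ size ys * n) /\
  (I ((\prod_(y <- ys) y) ^+ q * r) ->
   length_le I (ideal_add I (multiples r)) ((q.+1 ^ size ys).-1 * n)).
Proof.
move=> Kn; elim=> [|y ys IH] I r iI fullI ysI.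
  rewrite expn0 mul1n mul0n; split.
    apply: length_le_colon Kn => //; apply: ideal_gen_sub.
      exact: (colon_ideal _ iI).
    by move=> y /= /fullI[].
  (* With no variable left the top monomial is [r] itself; once it lies in [I], the only quotient is
     zero, which starts the saving of one. *)
  rewrite big_nil expr1n mul1r => Ir [//|k] [J [_ [_ nJI] /length_ge_sub JI]].
  case: nJI; apply: subset_trans JI _; apply: ideal_add_sub => //.
  exact: multiples_sub.
pose f j := ideal_add I (multiples (y ^+ j * r)).
have fi j : is_ideal (f j) by apply: ideal_add_ideal => //; apply: multiples_ideal.
have If j : I `<=` f j by apply/ideal_addl/multiples_ideal.
have fr j : f j (y ^+ j * r) by apply: ideal_addr => //; apply: multiples_id.
have fS j : f j.+1 `<=` f j.
  apply: ideal_add_sub => //; apply: multiples_sub => //.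
  by rewrite exprS -mulrA; apply: idealM.
have Ir c z : I (z * r) -> I (z * (c * r)) by rewrite mulrCA; apply: idealM.
have step j : length_le (f j.+1) (f j) (q.+1 ^ size ys * n) /\
  (I ((\prod_(y <- ys) y) ^+ q * (y ^+ j * r)) ->
   length_le (f j.+1) (f j) ((q.+1 ^ size ys).-1 * n)).
  have fj : f j `<=` ideal_add (f j.+1) (multiples (y ^+ j * r)).
    by move=> _ [u [v [Iu jv ->]]]; exists u, v; split=> //; apply: If.
  have [||H1 H2] := IH (f j.+1) (y ^+ j * r) (fi _).
  - move=> z /fullI[|Iz]; last by right; apply/If/Ir.
    rewrite inE => /predU1P[->|]; last by left.
    by right; rewrite mulrA -exprS; apply: fr.
  - by move=> z zys; apply/If/Ir/ysI; rewrite inE zys orbT.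
  split; first exact: length_le_sub H1.
  by move=> /If/H2; apply: length_le_sub.
have Sf k : length_le (f q.+1) (f 0%N) k -> length_le I (ideal_add I (multiples r)) k.
  apply: length_le_sub; last by rewrite /f mul1r.
  apply: ideal_add_sub => //; apply: multiples_sub => //.
  by apply: ysI; apply: mem_head.
have pos : (0 < q.+1 ^ size ys)%N by rewrite expn_gt0.
split=> [|Itop]; apply: Sf.
  have -> : (q.+1 ^ size (y :: ys) * n = \sum_(i < q.+1) q.+1 ^ size ys * n)%N.
    by rewrite sum_nat_const card_ord mulnA -expnS.
  apply: (@length_le_filtration f (fun=> q.+1 ^ size ys * n)%N) => // i _.
  exact: (step i).1.
(* Only the last layer, that of y^q, contains the top monomial, so it alone inherits the saving. *)
pose g i := ((if i == q then (q.+1 ^ size ys).-1 else q.+1 ^ size ys) * n)%N.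
have -> : ((q.+1 ^ size (y :: ys)).-1 * n = \sum_(i < q.+1) g i)%N.
  rewrite big_ord_recr /= /g eqxx (eq_bigr (fun=> q.+1 ^ size ys * n)%N).
    rewrite sum_nat_const card_ord mulnA -mulnDl expnS; congr (_ * _)%N.
    by move: (q.+1 ^ size ys)%N pos => e; nia.
  by move=> i _; rewrite ltn_eqF.
apply: (@length_le_filtration f g) => // i _; rewrite /g; case: eqP => [->|_].
  apply: (step q).2; rewrite mulrA; move: Itop.
  by rewrite big_cons exprMn [y ^+ q * _]mulrC.
exact: (step i).1.
Qed.

Lemma length_le_power (ys : seq R) q n :
  ideal_gen [set y ^+ q.+1 | y in [set` ys]] ((\prod_(y <- ys) y) ^+ q) ->
  length_le (ideal_gen [set` ys]) setT n ->
  length_le (ideal_gen [set y ^+ q.+1 | y in [set` ys]]) setT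
            ((q.+1 ^ size ys).-1 * n).
Proof.
set I := ideal_gen [set y ^+ _ | y in _] => Itop Kn.
have iI : is_ideal I by apply: ideal_gen_ideal.
have [||_ H] := @length_le_box ys q n Kn ys I 1 iI.
- by move=> y; left.
- by move=> y yys; rewrite mulr1; apply: sub_ideal_gen; exists y.
apply: length_le_sub (H _) => //; last by rewrite mulr1.
by move=> a _; apply: ideal_addr => //; exists a; rewrite mulr1.
Qed.

End Length.

(** * The monomial theorem *)

Section Growth.
Variable R : comNzRingType.
Hypothesis noethR : noetherian R.
Implicit Types (I J P : set R).

(** Put E = I^(n+e) + P. The chain counted by [b] is used above E + (x), which lies in I^(n+e) + P'.
    The chain counted by [a] is multiplied by [x] and placed between E and E + (x), where it stays
    strict since (E : x) lies in I^n + P by Artin-Rees. *)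
Lemma length_ge_colon_step I P P' x : is_ideal I -> prime_ideal P ->
    is_ideal P' -> P `<=` P' -> P' x -> ~ P x ->
  exists c, forall e n a b, (c <= e)%N ->
    length_ge (ideal_add (ideal_pow I n) P) setT a ->
    length_ge (ideal_add (ideal_pow I (n + e)) P') setT b ->
    length_ge (ideal_add (ideal_pow I (n + e)) P) setT (a + b).
Proof.
move=> iI pP iP' PP' P'x nPx; have iP := prime_ideal_ideal pP.
have [c colonP] := artin_rees_colon noethR iI pP nPx.
exists c => e n a b le_ce Ha Hb.
set E := ideal_add (ideal_pow I (n + e)) P.
have iE : is_ideal E by apply: ideal_add_ideal => //; apply: ideal_pow_ideal.
have Ecolon u : E (x * u) -> ideal_add (ideal_pow I n) P u.
  move=> [v [w [Iv Pw xu]]].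
  have [z [t [Iz Pt ->]]] : ideal_add (ideal_pow I (n + (e - c))) P u.
    by apply: colonP; rewrite -addnA subnK //; exists v, w.
  by exists z, t; split=> //; apply: ideal_pow_sub Iz; apply: leq_addr.
have imx := multiples_ideal x.
apply: (@length_ge_trans _ _ (ideal_add E (multiples x))); last first.
  apply: length_geS Hb; apply: ideal_add_sub; last 1 first.
  - apply: multiples_sub; last by apply: ideal_addr => //; exact: ideal_pow_ideal.
    by apply: ideal_add_ideal => //; apply: ideal_pow_ideal.
  - by apply: ideal_add_ideal => //; apply: ideal_pow_ideal.
  - by move=> _ [v [w [Iv Pw ->]]]; exists v, w; split=> //; apply: PP'.
pose mulx J := [set u | exists2 v, J v & u = x * v].
have imulx J : is_ideal J -> is_ideal (mulx J).
  move=> iJ; split; first by exists 0; [exact: ideal0 | rewrite mulr0].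
  - by move=> _ _ [v Jv ->] [w Jw ->]; exists (v + w); [exact: idealD | rewrite mulrDr].
  - by move=> r _ [v Jv ->]; exists (r * v); [exact: idealM | rewrite mulrCA].
suff : forall J, is_ideal J -> ideal_add (ideal_pow I n) P `<=` J ->
    length_ge J setT a -> length_ge (ideal_add E (mulx J)) (ideal_add E (multiples x)) a.
  move=> /(_ (ideal_add (ideal_pow I n) P)) H; apply: length_geS (H _ _ Ha) => //.
    by apply: ideal_addl; apply/imulx/ideal_add_ideal => //; apply: ideal_pow_ideal.
  by apply: ideal_add_ideal => //; apply: ideal_pow_ideal.
elim: (a) => [|k IH] J iJ FJ /=.
  move=> _ _ [u [_ [Eu [v Jv ->] ->]]]; exists u, (x * v); split=> //.
  by exists v; rewrite mulrC.
move=> [J' [iJ' [JJ' nJ'J] HJ']]; exists (ideal_add E (mulx J')); split.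
- exact/ideal_add_ideal/imulx.
- split.
    move=> _ [u [_ [Eu [v Jv ->] ->]]]; exists u, (x * v); split=> //.
    by exists v => //; apply: JJ'.
  move=> sub; apply: nJ'J => v J'v.
  have [w [_ [Ew [t Jt ->] E']]] : ideal_add E (mulx J) (x * v).
    by apply: sub; apply: ideal_addr => //; exists v.
  rewrite -[v](subrK t); apply: idealD => //; apply: FJ; apply: Ecolon.
  by rewrite mulrBr E' addrK.
- by apply: IH => //; apply: subset_trans JJ'.
Qed.

(** Summation of increments: raising the exponent from B (n + k) to B (n + k + 1) gains at least
    n^e, by induction for P_1; the [n] increments from B n to 2 B n give n^(e+1). *)
Lemma prime_chain_growth (m : set R) e (P : nat -> set R) : is_ideal m -> ~ m 1 ->
    (forall i, (i <= e)%N -> prime_ideal (P i)) ->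
    (forall i, (i < e)%N -> P i `<` P i.+1) -> P e `<=` m ->
  exists2 b, (0 < b)%N & forall n, (0 < n)%N ->
    length_ge (ideal_add (ideal_pow m (b * n)) (P 0%N)) setT (n ^ e).
Proof.
move=> im m1; elim: e P => [|e IH] P pP ltP Pm.
  exists 1%N => // n n_gt0; rewrite mul1n expn0; exists setT; split=> //.
  split=> // sub; apply: m1.
  have [u [v [/(ideal_pow1 im n_gt0) mu /Pm mv ->]]] := sub 1 I.
  exact: idealD.
have [||b b_gt0 Hb] := IH (fun i => P i.+1) _ _ Pm.
- by move=> i le_ie; apply: pP.
- by move=> i lt_ie; apply: ltP.
have [P01 nP10] := ltP 0%N isT.
have [x P1x nP0x] : exists2 x, P 1%N x & ~ P 0%N x.
  apply: contrapT => nex; apply: nP10 => a P1a.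
  by apply: contrapT => nP0a; apply: nex; exists a.
have [c Hc] := length_ge_colon_step im (pP 0%N isT) (prime_ideal_ideal (pP 1%N isT)) P01 P1x nP0x.
(* A multiple of [b], so that the induction hypothesis applies, and at least the Artin-Rees constant
   [c]. *)
pose B := (b * c.+1)%N.
have step n k : (0 < n)%N ->
    length_ge (ideal_add (ideal_pow m (B * (n + k))) (P 0%N)) setT (k * n ^ e).
  move=> n_gt0; elim: k => [|k IHk]; first by [].
  have -> : (B * (n + k.+1) = B * (n + k) + B)%N by lia.
  rewrite mulSn [(n ^ e + _)%N]addnC; apply: Hc => //; first by rewrite /B; nia.
  have -> : (B * (n + k) + B = b * (c.+1 * (n + k.+1)))%N by rewrite /B; lia.
  apply: length_ge_leq (Hb _ _); last by rewrite muln_gt0 addn_gt0 n_gt0.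
  by have [->|e_gt0] := posnP e; [rewrite !expn0 | rewrite leq_exp2r //; nia].
exists (B * 2)%N; first by rewrite /B !muln_gt0 b_gt0.
move=> n n_gt0; rewrite expnS -mulnA mul2n -addnn; exact: step.
Qed.

Lemma length_ge_pow_chain (m : set R) d : local_with_max m -> prime_chain R d ->
  exists2 b, (0 < b)%N &
    forall n, (0 < n)%N -> length_ge (ideal_pow m (b * n)) setT (n ^ d).
Proof.
move=> localR [P [pP ltP]]; have im := max_ideal_ideal localR.
have nm1 : ~ m 1 by case: localR => -[].
have [|||b b_gt0 Hb] := @prime_chain_growth m d (fun i => P (inord i)) im nm1.
- by [].
- by move=> i lt_id; apply: ltP; rewrite !inordK // ltnW.
- exact: prime_sub_max.
exists b => // n n_gt0; apply: length_geS (Hb n n_gt0).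
by apply: ideal_addl; apply: prime_ideal_ideal.
Qed.

Lemma length_le_max (m : set R) : local_with_max m -> length_le m setT 1.
Proof.
move=> localR [|[|k]] //= [I1 [i1 [mI1 nI1m] [I2 [_ [_ nI21] _]]]].
case: nI21; have [/(ideal_1 i1) I1T|nI11] := pselect (I1 1); first by move=> a _; exact: I1T.
by case: nI1m; apply: proper_sub_max.
Qed.

(** As long as (I : r) is not prime, some [a] outside it makes (I : a r) strictly larger. Noetherian
    induction ends at an associated prime of R/I, which has to be [m]. *)
Lemma exists_socle (m : set R) I : is_ideal I -> ~ I 1 ->
    (forall P, prime_ideal P -> I `<=` P -> P = m) ->
  exists2 r, ~ I r & forall a, m a -> I (a * r).
Proof.
move=> iI nI1 Im.
suff H : forall J, is_ideal J -> forall r, ~ I r -> J = colon I r ->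
    exists2 r, ~ I r & forall a, m a -> I (a * r).
  exact: (H _ (colon_ideal 1 iI) 1).
apply: noetherian_ind => // J iJ IH r nIr Jr.
have [pJ|npJ] := pselect (prime_ideal J).
  have <- : J = m by apply: Im => // a Ia; rewrite Jr /colon /=; apply: idealMR.
  by exists r => // a; rewrite Jr.
have [a [b [Jab nJa nJb]]] : exists a b, [/\ J (a * b), ~ J a & ~ J b].
  apply: contrapT => nex; apply: npJ; split=> //.
    by rewrite Jr /colon /= mul1r.
  move=> a b Jab; apply: contrapT => nor; apply: nex; exists a, b.
  by split=> // ?; apply: nor; tauto.
apply: (IH (colon I (a * r)) (colon_ideal _ iI) _ (a * r)) => //; last by move: nJa; rewrite Jr.
split=> [c|].
  by rewrite Jr /colon /= => Icr; rewrite mulrCA; apply: idealM.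
move=> /(_ b); rewrite /colon /= => sub; apply: nJb; apply: sub.
by move: Jab; rewrite Jr /colon /= mulrA [b * a]mulrC.
Qed.

(** Adding a socle element to [I] costs length at most one, being a quotient of R/m. *)
Lemma finite_length (m : set R) I : local_with_max m -> is_ideal I ->
    (forall P, prime_ideal P -> I `<=` P -> P = m) ->
  exists n, length_le I setT n.
Proof.
move=> localR; move: I; apply: noetherian_ind => // I iI IH Im.
have [I1|nI1] := pselect (I 1).
  exists 0%N => -[//|k] [J [_ [_ nJI] _]]; case: nJI => a _.
  exact: ideal_1.
have [r nIr mr] := exists_socle iI nI1 Im.
have [iJ pJ] := proper_add_multiples iI nIr.
have [|n Hn] := IH _ iJ pJ.
  by move=> P pP JP; apply: Im => //; apply: subset_trans JP; apply: properW.
exists (1 + n)%N; apply: (length_le_trans iI iJ) Hn => //; first exact: properW.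
by apply: length_le_colon (length_le_max localR) => // a /mr.
Qed.

(** By Bernoulli's inequality (X/(X-1))^j is unbounded in [j]. *)
Lemma power_lt_contra X b C : (0 < X)%N ->
  ~ forall j, (X ^ j <= X.-1 ^ (b + j) * C)%N.
Proof.
case: X => // Y _ /= H.
have bern j : (Y ^ j * (Y + j.+1) <= Y.+1 ^ j.+1)%N.
  elim: j => [|j IHj]; first by rewrite expn0 expn1; lia.
  rewrite [(Y.+1 ^ _)%N]expnS; apply: leq_trans (leq_mul (leqnn Y.+1) IHj).
  by rewrite expnS; nia.
(* With j = Y^b C Y, the bound at [j + 1] and Bernoulli give, after division by Y^j, the absurd Y +
   j + 1 <= j. *)
have := H (Y ^ b * C * Y).+1; rewrite expnD.
set D := (Y ^ b * C)%N; set j := (D * Y)%N.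
have := bern j; rewrite [(Y ^ j.+1)%N]expnS.
have [->|Y_gt0] := posnP Y; first by rewrite exp1n !mul0n muln0 mul0n.
have : (0 < Y ^ j)%N by rewrite expn_gt0 Y_gt0.
move: (Y ^ j)%N => Z Z_gt0 le1 le2.
have := leq_trans le1 le2.
have -> : (Y ^ b * (Y * Z) * C = Z * (D * Y))%N by rewrite /D; lia.
by rewrite leq_pmul2l // /j; lia.
Qed.

Lemma monomial_notin p (m : set R) d (x : seq R) t : p \in [pchar R] ->
    local_with_max m -> prime_chain R d -> size x = d ->
    (forall a, a \in x -> m a) ->
    (forall P, prime_ideal P -> (forall a, a \in x -> P a) -> P = m) ->
  ~ ideal_gen [set a ^+ t.+1 | a in [set` x]] ((\prod_(a <- x) a) ^+ t).
Proof.
move=> charR localR chainR szx xm Vx xt.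
pose G N : set R := ideal_gen [set a ^+ N | a in [set` x]].
pose u := \prod_(a <- x) a.
have iG N : is_ideal (G N) by apply: ideal_gen_ideal.
have Ga N a c : a \in x -> G N (c * a ^+ N).
  by move=> ax; apply: (idealM _ (iG N)); apply: sub_ideal_gen; exists a.
have ux a : a \in x -> exists c, u = c * a.
  by move=> ax; rewrite /u (big_rem a) //= mulrC; eexists.
have p_gt1 : (1 < p)%N by apply: prime_gt1; apply: pcharf_prime charR.
(* Multiplying by u^(q - t) raises the exponents of [u] and of every x_i alike, since each x_i
   divides [u]; p^(t+1) > t ensures [q >= t]. *)
pose q := (p ^ t.+1).-1.
have qE : q.+1 = (p ^ t.+1)%N by rewrite prednK // expn_gt0 ltnW.
have le_tq : (t <= q)%N.
  by rewrite -ltnS qE; apply: ltn_trans (ltn_expl _ p_gt1).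
have uq : G q.+1 (u ^+ q).
  rewrite -(subnKC le_tq) exprD.
  apply: (xt (colon (G (t + (q - t)).+1) (u ^+ (q - t)))).
    exact: colon_ideal.
  move=> _ [a ax <-]; rewrite /colon /=; have [c ->] := ux a ax.
  by rewrite exprMn mulrCA -exprD addSn; apply: Ga.
have frob k : G (q.+1 ^ k * q.+1)%N ((u ^+ (q.+1 ^ k)) ^+ q).
  rewrite exprAC -exprM.
  (* The preimage of an ideal under a power of Frobenius is an ideal; this one contains every
     x_i^(q+1), hence u^q. *)
  have iF : is_ideal [set a | G (q.+1 ^ k * q.+1)%N (a ^+ (q.+1 ^ k))].
    have charq : [pchar R].-nat (q.+1 ^ k)%N.
      rewrite qE -expnM (eq_pnat _ (pcharf_eq charR)) pnatX pnat_id ?orTb //.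
      exact: pcharf_prime charR.
    split=> /= [|a b Ga' Gb|r a Ga'].
    - by rewrite expr0n expn_eq0 /=; apply: (ideal0 (iG _)).
    - by rewrite exprDn_pchar //; apply: (idealD (iG _)).
    - by rewrite exprMn; apply: (idealM _ (iG _)).
  rewrite exprM; apply: (uq _ iF) => _ [a ax <-] /=.
  by rewrite -exprM mulnC -[X in G _ X]mul1r; apply: Ga.
have [C HC] : exists C, length_le (G 1%N) setT C.
  apply: (finite_length localR) => // P pP GP; apply: Vx => // a ax.
  by apply: GP; rewrite -[a]mul1r -[a]expr1; apply: Ga.
have upper k : length_le (G (q.+1 ^ k)%N) setT ((q.+1 ^ d).-1 ^ k * C).
  elim: k => [|k IH]; first by rewrite !expn0 mul1n.
  pose y := [seq a ^+ (q.+1 ^ k) | a <- x].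
  have Gy N : ideal_gen [set a ^+ N | a in [set` y]] = G (q.+1 ^ k * N)%N.
    congr ideal_gen; apply/seteqP; split.
      by move=> _ [_ /= /mapP[a ax ->] <-]; exists a => //; rewrite exprM.
    by move=> _ [a ax <-]; exists (a ^+ (q.+1 ^ k)); rewrite ?exprM //; apply/mapP; exists a.
  have Gy1 : ideal_gen [set` y] = G (q.+1 ^ k)%N.
    by rewrite -[X in G X]muln1 -Gy; congr ideal_gen; apply/seteqP; split=> [a ay|_ [a ay <-]];
      [exists a; rewrite ?expr1 | rewrite expr1].
  have := @length_le_power R y q ((q.+1 ^ d).-1 ^ k * C)%N.
  rewrite Gy Gy1 size_map szx -expnSr mulnA -expnS; apply=> //.
  by rewrite big_map prodrXl expnSr; apply: frob.
have [b b_gt0 lower] := length_ge_pow_chain localR chainR.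
(* With Q = q + 1, the inequality b <= Q^b places the powers x_i^(Q^(b+j)) in m^(b Q^j), whose
   colength is at least (Q^j)^d. *)
apply: (@power_lt_contra (q.+1 ^ d) b C); first by rewrite expn_gt0.
move=> j; apply: upper; rewrite -expnM mulnC expnM.
apply: length_geS (lower _ _); last by rewrite expn_gt0.
have im := max_ideal_ideal localR.
apply: ideal_gen_sub; first exact: ideal_pow_ideal.
move=> _ [a ax <-]; apply: (@ideal_pow_sub _ _ _ (q.+1 ^ (b + j))%N).
  by rewrite expnD leq_mul2r ltnW ?orbT // ltn_expl // qE (@ltn_exp2l _ 0) .
exact/ideal_powX/xm.
Qed.

End Growth.

(** * Torsion of Cech cohomology *)

(* [fraction.v] also exports a [frac]. *)
Local Notation frac := Defs.frac.

Section Torsion.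
Variable R : comNzRingType.
Implicit Types (M N : lmodType R) (f y v r : R) (ys us vs : seq R).

Lemma frac_eq0 M f (a : M) n : frac f a n = 0 <-> exists l, f ^+ l *: a = 0.
Proof.
have -> : (0 : loc M f) = frac f 0 0 by [].
split=> [/eqP/frac_eqP[l]|[l fa]].
  by rewrite scaler0; exists (l + 0)%N.
by apply/eqP/frac_eqP; exists l; rewrite addn0 scaler0.
Qed.

Lemma radical_span (I : set R) s r : is_ideal I ->
  (forall y, y \in s -> exists n, I (y ^+ n)) -> ideal_span s r ->
  exists n, I (r ^+ n).
Proof.
move=> iI sI; have : is_ideal [set a | exists n, I (a ^+ n)].
  split=> [|a b [i Ia] [j Ib]|c a [i Ia]].
  - by exists 1%N; rewrite expr1; apply: ideal0.
  - exists (i + j)%N; rewrite exprDn; apply: ideal_sum => // k _.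
    rewrite -mulr_natl; apply: idealM => //.
    have [le_jk|/ltnW le_kj] := leqP j k.
      by apply: idealM => //; rewrite -(subnK le_jk) exprD; apply: idealM.
    apply: idealMR => //; rewrite -addnBA // addnC exprD.
    exact: idealM.
  - by exists i; rewrite exprMn; apply: idealM.
by move=> irad; apply: (ideal_span_sub irad).
Qed.

Definition bij_scale y M :=
  (forall z : M, y *: z = 0 -> z = 0) /\ (forall z : M, exists w, z = y *: w).

Lemma bij_scale_loc y f M : bij_scale y M -> bij_scale y (loc M f).
Proof.
move=> [yinj ysurj]; split=> z; have [a [n ->]] := fracP z.
  rewrite fracZ => /frac_eq0[l]; rewrite scalerA mulrC -scalerA => /yinj fa.
  by apply/frac_eq0; exists l.
by have [w ->] := ysurj a; exists (frac f w n); rewrite fracZ.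
Qed.

Lemma bij_scale_loc_self y M : bij_scale y (loc M y).
Proof.
split=> z; have [a [n ->]] := fracP z.
  rewrite fracZ => /frac_eq0[l]; rewrite scalerA -exprSr => ya.
  by apply/frac_eq0; exists l.+1.
by exists (frac y a n.+1); rewrite fracZ (frac_expand y a n 1) expr1.
Qed.

Lemma bij_scale_cech y ys M k : bij_scale y M -> bij_scale y (cech ys M k).
Proof.
elim: ys M k => [|u ys IH] M [|k] yM //=.
- by split=> z; [rewrite [z]thinmx0 | exists 0; rewrite [z]thinmx0 scaler0].
- exact: IH.
have [inj1 surj1] := IH M k.+1 yM; have [inj2 surj2] := IH _ k (bij_scale_loc u yM).
split=> -[a b].
  by case=> /inj1 -> /inj2 ->.
by have [[a' ->] [b' ->]] := conj (surj1 a) (surj2 b); exists (a', b').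
Qed.

(* [g] behaves like the localization map at [y], up to the action of [y] on its
   target. *)
Definition loc_like y M N (g : M -> N) :=
  (forall z, exists n w, g w = y ^+ n *: z) /\
  (forall w, g w = 0 -> exists n, y ^+ n *: w = 0).

Lemma loc_like_to_loc y M : loc_like y (@to_loc R M y).
Proof.
split=> [z|w /frac_eq0 //]; have [a [n ->]] := fracP z.
exists n, a; rewrite fracZ /to_loc (frac_expand _ a 0 n) addn0.
by apply/eqP/frac_eqP; exists 0%N.
Qed.

Lemma loc_like_loc_fun y f M N (g : {linear M -> N}) :
  loc_like y g -> loc_like y (@loc_fun R M N f g).
Proof.
move=> [gsurj ginj]; split=> z; have [a [n ->]] := fracP z.
  by have [k [w gw]] := gsurj a; exists k, (frac f w n); rewrite loc_funE gw fracZ.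
rewrite loc_funE => /frac_eq0[l]; rewrite -linearZ => /ginj[k].
rewrite scalerA mulrC -scalerA => ya.
by exists k; rewrite fracZ; apply/frac_eq0; exists l.
Qed.

Lemma loc_like_cech_map y ys M N (g : {linear M -> N}) k :
  loc_like y g -> loc_like y (@cech_map R ys M N g k).
Proof.
elim: ys M N g k => [|u ys IH] M N g [|k] yg //=.
- by split=> z; [exists 0%N, z; rewrite expr0 scale1r | exists 0%N; rewrite [z]thinmx0 scaler0].
- exact: IH.
have [surj1 inj1] := IH M N g k.+1 yg.
have [surj2 inj2] := IH _ _ _ k (loc_like_loc_fun u yg).
split=> [[a b]|[a b] [/inj1[n ya] /inj2[n' yb]]].
  have [n [a' ga]] := surj1 a; have [n' [b' gb]] := surj2 b.
  exists (n + n')%N, (y ^+ n' *: a', y ^+ n *: b') => /=.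
  by rewrite !linearZ_LR /= ga gb !scalerA -!exprD addnC.
exists (n + n')%N.
suff : (y ^+ (n + n') *: a, y ^+ (n + n') *: b) = (0, 0) by [].
congr pair.
  by rewrite addnC exprD -scalerA ya scaler0.
by rewrite exprD -scalerA yb scaler0.
Qed.

(** The inclusions of the two summands of the cone, uniform in the degree: in degree 0 the second
    summand is zero, in accordance with [cech_pre]. *)
Definition cone_inl y ys M k : cech ys M k -> cech (y :: ys) M k :=
  match k return cech ys M k -> cech (y :: ys) M k with
  | 0 => id
  | k'.+1 => fun a => (a, 0)
  end.

Definition cone_inr y ys M k : cech_pre ys (loc M y) k -> cech (y :: ys) M k :=
  match k return cech_pre ys (loc M y) k -> cech (y :: ys) M k with
  | 0 => fun=> 0
  | k'.+1 => fun b => (0, b)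
  end.

Lemma cech_diff_inl y ys M k (a : cech ys M k) :
  cech_diff (cone_inl y a) = (cech_diff a, cech_map (@to_loc R M y) a).
Proof. by case: k a => //= k a; rewrite raddf0 subr0. Qed.

Lemma cech_diff_inr y ys M k (b : cech_pre ys (loc M y) k) :
  cech_diff (cone_inr b) = (0, - cech_into b).
Proof.
case: k b => [|k] b /=; first by rewrite !raddf0.
by rewrite !raddf0 add0r.
Qed.

Lemma cech_into_cone y ys M k (a : cech ys M k) (b : cech_pre ys (loc M y) k) :
  @cech_into R (y :: ys) M k.+1 (cone_inl y a + cone_inr b) =
  (cech_diff a, cech_map (@to_loc R M y) a - cech_into b).
Proof.
transitivity (cech_diff (cone_inl y a) + cech_diff (cone_inr b)).
  exact: raddfD.
rewrite cech_diff_inl cech_diff_inr.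
have -> : forall (p q : cech ys M k.+1) (p' q' : cech ys (loc M y) k),
    (p, p') + (q, q') = (p + q, p' + q') by [].
by rewrite addr0.
Qed.

(** If [y] is the head, the complex is the cone of a map that becomes bijective up to powers of [y].
    If [y] is in the tail, the induction applies to both ends of the cone, one after the other. *)
Lemma cech_torsion ys M k (z : cech ys M k) y : y \in ys -> cech_diff z = 0 ->
  exists n u, cech_into u = y ^+ n *: z.
Proof.
elim: ys M k z => // x ys IH M [|k] z.
  rewrite inE => yx /= [dz mz].
  suff [n yz] : exists n, y ^+ n *: z = 0 by exists n, 0.
  have [yx'|nyx] := eqVneq y x.
    by subst; have [_] := loc_like_cech_map ys 0 (loc_like_to_loc x M); apply.
  case/orP: yx => [/eqP|ys_y]; first by move/eqP: nyx.
  by have [n [u E]] := IH M 0%N z ys_y dz; exists n; rewrite -E.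
case: z => a b yx [da /eqP]; rewrite subr_eq0 => /eqP mab.
suff [n [a' [b' [Ea Eb]]]] : exists n (a' : cech ys M k) (b' : cech_pre ys (loc M x) k),
    cech_diff a' = y ^+ n *: a /\
    cech_map (@to_loc R M x) a' - cech_into b' = y ^+ n *: b.
  exists n, (cone_inl x a' + cone_inr b').
  by apply: etrans (cech_into_cone a' b') _; rewrite Ea Eb.
have [yx'|nyx] := eqVneq y x.
  subst x; have yl := loc_like_to_loc y M.
  have [/(_ b)[n [a' ma']] _] := loc_like_cech_map ys k yl.
  have [_ /(_ (cech_diff a' - y ^+ n *: a))[|n' E]] := loc_like_cech_map ys k.+1 yl.
    by rewrite raddfB /= -cech_diff_map ma' !linearZ_LR /= mab -scalerDr subrr scaler0.
  exists (n + n')%N, (y ^+ n' *: a'), 0; split.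
    rewrite linearZ_LR addnC exprD -scalerA; apply/eqP.
    by rewrite -subr_eq0 -scalerBr E.
  by rewrite raddf0 subr0 linearZ_LR /= ma' scalerA -exprD addnC.
have {yx} ys_y : y \in ys by move: yx; rewrite inE (negPf nyx).
have [n [a' Ea]] : exists n (a' : cech ys M k), cech_diff a' = y ^+ n *: a.
  exact: IH M k.+1 a ys_y da.
(* What the primitive [a'] leaves of the second component is a cocycle over [loc M x], so it can be
   treated in turn. *)
pose b1 := y ^+ n *: b - cech_map (@to_loc R M x) a'.
have db1 : cech_diff b1 = 0.
  by rewrite raddfB /= cech_diff_map Ea !linearZ_LR /= mab -scalerDr subrr scaler0.
have [n' [b' Eb]] := IH _ k b1 ys_y db1.
exists (n + n')%N, (y ^+ n' *: a'), (- b'); split.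
  by rewrite linearZ_LR /= Ea scalerA -exprD addnC.
rewrite raddfN opprK /= Eb /b1 [cech_map _ (_ *: _)]linearZ_LR /= scalerBr.
by rewrite addrC subrK scalerA -exprD addnC.
Qed.

End Torsion.

(** * Changing the family of a Cech complex *)

Section Drop.
Variable R : comNzRingType.
Implicit Types (M N : lmodType R) (y v : R) (us vs ws : seq R).

(* Restriction of cochains forgetting the element [v] of the family. *)
Fixpoint cech_drop us v ws M k : cech (us ++ v :: ws) M k -> cech (us ++ ws) M k :=
  match us, k return cech (us ++ v :: ws) M k -> cech (us ++ ws) M k with
  | [::], 0 => id
  | [::], _.+1 => fst
  | u :: us', 0 => @cech_drop us' v ws M 0
  | u :: us', k'.+1 => fun ab =>
      (@cech_drop us' v ws M k'.+1 ab.1, @cech_drop us' v ws (loc M u) k' ab.2)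
  end.

Lemma cech_drop_linear us v ws M k : linear (@cech_drop us v ws M k).
Proof.
elim: us M k => [|u us IH] M [|k] /=.
- by [].
- by move=> r [a b] [a' b'].
- exact: IH.
- by move=> r [a b] [a' b'] /=; rewrite !IH.
Qed.

HB.instance Definition _ us v ws M k :=
  GRing.isLinear.Build R (cech (us ++ v :: ws) M k) (cech (us ++ ws) M k) _
    (@cech_drop us v ws M k) (@cech_drop_linear us v ws M k).

Lemma cech_drop_map us v ws M N (g : {linear M -> N}) k (a : cech (us ++ v :: ws) M k) :
  cech_drop (cech_map g a) = cech_map g (cech_drop a).
Proof. by elim: us M N g k a => [|u us IH] M N g [|k] //= a; rewrite !IH. Qed.

Lemma cech_drop_diff us v ws M k (a : cech (us ++ v :: ws) M k) :
  cech_drop (cech_diff a) = cech_diff (cech_drop a).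
Proof.
elim: us M k a => [|u us IH] M [|k] //= a; first by rewrite IH cech_drop_map.
by rewrite IH raddfB /= IH cech_drop_map.
Qed.

Lemma cech_drop_cocycle us v ws M k (a : cech (us ++ v :: ws) M k) :
  cech_diff a = 0 -> cech_diff (cech_drop a) = 0.
Proof. by rewrite -cech_drop_diff => ->; rewrite raddf0. Qed.

Lemma cech_drop_surj us v ws M k (c : cech (us ++ ws) M k) :
  exists a : cech (us ++ v :: ws) M k, cech_drop a = c.
Proof.
elim: us M k c => [|u us IH] M [|k] /= c.
- by exists c.
- by exists (c, 0).
- exact: IH.
have [[a Ea] [b Eb]] := conj (IH _ _ c.1) (IH _ _ c.2).
by exists (a, b); rewrite /= Ea Eb -surjective_pairing.
Qed.

(** The kernel collects the components whose index set contains [v], and these are localized at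
    [v]. *)
Lemma cech_drop_ker_bij us v ws M k (z : cech (us ++ v :: ws) M k) :
  cech_drop z = 0 ->
  (v *: z = 0 -> z = 0) /\ exists w : cech (us ++ v :: ws) M k, cech_drop w = 0 /\ z = v *: w.
Proof.
elim: us M k z => [|u us IH] M [|k] /= z.
- by move=> ->; split=> //; exists 0; rewrite scaler0.
- have [vinj vsurj] := bij_scale_cech ws k (bij_scale_loc_self v M).
  case: z => [a b] /= ->; split; first by case=> _ /vinj ->.
  have [b' ->] := vsurj b; exists (0, b'); split=> //.
  by suff : (0, v *: b') = (v *: 0, v *: b') :> cech ws M k.+1 * cech ws (loc M v) k
    by []; rewrite scaler0.
- exact: IH.
case: z => a b /= [/IH[ainj [a' [Da' Ea]]] /IH[binj [b' [Db' Eb]]]].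
split; first by case=> /ainj -> /binj ->.
by exists (a', b'); rewrite /= Da' Db' {1}Ea {1}Eb.
Qed.

Lemma cech_drop_ker_bijX us v ws M k n (z : cech (us ++ v :: ws) M k) :
  cech_drop z = 0 ->
  (v ^+ n *: z = 0 -> z = 0) /\
  exists w : cech (us ++ v :: ws) M k, cech_drop w = 0 /\ z = v ^+ n *: w.
Proof.
elim: n z => [|n IH] z Dz; first by rewrite expr0 scale1r; split=> //; exists z; rewrite scale1r.
have [zinj [w [Dw Ew]]] := IH z Dz; split.
  rewrite exprS -scalerA => vz; apply: zinj.
  by apply: (cech_drop_ker_bij _).1 vz; rewrite linearZ_LR /= Dz scaler0.
have [_ [w' [Dw' Ew']]] := cech_drop_ker_bij Dw.
by exists w'; rewrite Ew Ew' scalerA -exprSr.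
Qed.

(** A primitive [w] of y^n z in the whole complex restricts to a cocycle. A further power of [y]
    makes this restriction a boundary, whose lift is subtracted to bring the primitive into the
    kernel. *)
Lemma cech_drop_ker_torsion us v ws M k (z : cech (us ++ v :: ws) M k.+1) y :
  y \in us ++ ws -> cech_drop z = 0 -> cech_diff z = 0 ->
  exists n (w : cech (us ++ v :: ws) M k), cech_drop w = 0 /\ cech_diff w = y ^+ n *: z.
Proof.
move=> yin Dz dz.
have yin' : y \in us ++ v :: ws.
  by move: yin; rewrite !mem_cat inE orbCA => ->; rewrite orbT.
have [n [w Ew]] : exists n (w : cech (us ++ v :: ws) M k), cech_diff w = y ^+ n *: z.
  exact: (@cech_torsion R _ M k.+1).
have dDw : cech_diff (cech_drop w) = 0.
  by rewrite -cech_drop_diff Ew linearZ_LR /= Dz scaler0.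
have [n' [w2 Ew2]] := cech_torsion yin dDw.
(* The boundary is lifted as the boundary of a lifted cochain, so the lift is closed; in degree 0 it
   is zero. *)
have [w3 [Dw3 dw3]] : exists w3 : cech (us ++ v :: ws) M k,
    cech_drop w3 = cech_into w2 /\ cech_diff w3 = 0.
  case: (k) w2 {Ew2 dDw Ew w Dz dz z} => [|k'] w2.
    by exists 0; rewrite !raddf0.
  have [w3 Dw3] := cech_drop_surj v w2.
  by exists (cech_diff w3); rewrite cech_diffK cech_drop_diff Dw3.
exists (n + n')%N, (y ^+ n' *: w - w3); split.
  by rewrite raddfB /= linearZ_LR /= Dw3 Ew2 subrr.
by rewrite raddfB /= dw3 subr0 linearZ_LR /= Ew scalerA -exprD addnC.
Qed.

Lemma cech_drop_acyclic0 us v ws M n (z : cech (us ++ v :: ws) M 0) :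
  ideal_span (us ++ ws) (v ^+ n) -> cech_drop z = 0 -> cech_diff z = 0 -> z = 0.
Proof.
move=> vn Dz dz; pose I : set R := [set r | r *: z = 0].
have iI : is_ideal I.
  split=> [|a b Ia Ib|a b Ib]; rewrite /I /=; first by rewrite scale0r.
    by rewrite scalerDl Ia Ib addr0.
  by rewrite -scalerA Ib scaler0.
have [|l] := radical_span iI _ vn.
  move=> y yin; have [|n' [u E]] := cech_torsion (_ : y \in us ++ v :: ws) dz.
    by move: yin; rewrite !mem_cat inE orbCA => ->; rewrite orbT.
  by exists n'; rewrite /I /= -E.
by rewrite -exprM /I /= => /(cech_drop_ker_bijX _ Dz).1.
Qed.

Lemma cech_drop_acyclicS us v ws M k n (z : cech (us ++ v :: ws) M k.+1) :
  ideal_span (us ++ ws) (v ^+ n) -> cech_drop z = 0 -> cech_diff z = 0 ->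
  exists w : cech (us ++ v :: ws) M k, cech_drop w = 0 /\ cech_diff w = z.
Proof.
move=> vn Dz dz.
(* The annihilator of the class of [z] in the kernel complex; its radical contains the remaining
   family, hence [v]. *)
pose I : set R := [set r | exists w : cech (us ++ v :: ws) M k,
  cech_drop w = 0 /\ cech_diff w = r *: z].
have iI : is_ideal I.
  split.
  - by exists 0; rewrite !raddf0 scale0r.
  - move=> a b [w [Dw dw]] [w' [Dw' dw']]; exists (w + w').
    by rewrite !raddfD /= Dw Dw' dw dw' addr0 scalerDl.
  - move=> a b [w [Dw dw]]; exists (a *: w).
    by rewrite !linearZ_LR /= Dw dw scaler0 scalerA.
have [|l] := radical_span iI _ vn.
  by move=> y yin; apply: cech_drop_ker_torsion.
rewrite -exprM => -[w [Dw dw]].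
(* The primitive of v^(n l) z is divided by v^(n l) inside the kernel; injectivity then removes the
   factor from the equation. *)
have [_ [w' [Dw' Ew]]] := cech_drop_ker_bijX (n * l) Dw.
exists w'; split=> //; apply/eqP; rewrite -subr_eq0; apply/eqP.
have := @cech_drop_ker_bijX us v ws M k.+1 (n * l) (cech_diff w' - z).
case; first by rewrite raddfB /= cech_drop_diff Dw' raddf0 Dz subrr.
by move=> + _; apply; rewrite scalerBr -dw Ew linearZ_LR subrr.
Qed.

(** After subtraction of a lifted primitive, [z] lies in the kernel complex, which is acyclic. *)
Lemma cech_drop_inj us v ws M k n (z : cech (us ++ v :: ws) M k) u :
  ideal_span (us ++ ws) (v ^+ n) -> cech_diff z = 0 -> cech_drop z = cech_into u ->
  exists u', cech_into u' = z.
Proof.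
move=> vn; case: k z u => [|k] z u dz Dz.
  by exists 0; rewrite raddf0 (cech_drop_acyclic0 vn _ dz).
have [u1 Du1] := cech_drop_surj v u.
have [||w [_ dw]] := @cech_drop_acyclicS us v ws M k n (z - cech_diff u1) vn.
- by rewrite raddfB /= cech_drop_diff Du1 Dz subrr.
- by rewrite raddfB /= dz cech_diffK subrr.
by exists (w + u1 : cech (us ++ v :: ws) M k); rewrite raddfD /= dw subrK.
Qed.

(** The differential of any lift of [c] is a cocycle of the acyclic kernel; a primitive there
    corrects the lift. *)
Lemma cech_drop_lift us v ws M k n (c : cech (us ++ ws) M k) :
  ideal_span (us ++ ws) (v ^+ n) -> cech_diff c = 0 ->
  exists2 z : cech (us ++ v :: ws) M k, cech_diff z = 0 & cech_drop z = c.
Proof.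
move=> vn dc; have [s Ds] := cech_drop_surj v c.
have [||w [Dw dw]] := @cech_drop_acyclicS us v ws M k n (cech_diff s) vn.
- by rewrite cech_drop_diff Ds.
- exact: cech_diffK.
by exists (s - w); rewrite raddfB /= ?dw ?subrr // Ds Dw subr0.
Qed.

Lemma ideal_span_subseq vs ws a : {subset vs <= ws} -> ideal_span vs a -> ideal_span ws a.
Proof.
move=> sub; apply: ideal_span_sub; first exact: ideal_span_ideal.
by move=> r /sub; apply: ideal_span_mem.
Qed.

Lemma cech_resr_cons u us vs M k (a : cech ((u :: us) ++ vs) M k) :
  @cech_resr R (u :: us) vs M k a =
  @cech_resr R us vs M k (@cech_drop [::] u (us ++ vs) M k a).
Proof. by case: k a. Qed.

Lemma cech_resl_cons us v vs M k (a : cech (us ++ v :: vs) M k) :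
  @cech_resl R us (v :: vs) M k a = @cech_resl R us vs M k (cech_drop a).
Proof. by elim: us M k a => [|u us IH] M [|k] //= a; rewrite !IH. Qed.

Lemma cech_resr_inj us vs M k (z : cech (us ++ vs) M k) u :
  (forall y, y \in us -> exists n, ideal_span vs (y ^+ n)) ->
  cech_diff z = 0 -> @cech_resr R us vs M k z = cech_into u -> exists u', cech_into u' = z.
Proof.
elim: us z => [|y us IH] z usvs dz rz; first by exists u.
have [n yn] := usvs y (mem_head _ _).
rewrite cech_resr_cons in rz; have [||u' Eu'] := IH _ _ _ rz.
- by move=> y' y'us; apply: usvs; rewrite inE y'us orbT.
- exact: (@cech_drop_cocycle [::] y (us ++ vs)).
apply: (@cech_drop_inj [::] y (us ++ vs) M k n z u') => //.
by apply: ideal_span_subseq yn => a; rewrite /= mem_cat orbC => ->.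
Qed.

Lemma cech_resr_lift us vs M k (c : cech vs M k) :
  (forall y, y \in us -> exists n, ideal_span vs (y ^+ n)) -> cech_diff c = 0 ->
  exists2 z : cech (us ++ vs) M k, cech_diff z = 0 & @cech_resr R us vs M k z = c.
Proof.
elim: us => [|y us IH] usvs dc; first by exists c.
have [n yn] := usvs y (mem_head _ _).
have [|//|z dz rz] := IH.
  by move=> y' y'us; apply: usvs; rewrite inE y'us orbT.
have [||z' dz' Dz'] := @cech_drop_lift [::] y (us ++ vs) M k n z => //.
  by apply: ideal_span_subseq yn => a; rewrite /= mem_cat orbC => ->.
by exists z' => //; rewrite cech_resr_cons Dz'.
Qed.

(** [cech (us ++ [::])] and [cech us] are not convertible; the restriction identifies them at the
    base of the inductions on [vs]. *)
Lemma cech_resl_nil_bij us M k :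
  injective (@cech_resl R us [::] M k) /\
  forall c, exists z, @cech_resl R us [::] M k z = c.
Proof.
elim: us M k => [|u us IH] M [|k] /=.
- by split=> [z z' //|c]; exists c.
- by split=> [z z' //|c]; exists c.
- exact: IH.
have [inj1 surj1] := IH M k.+1; have [inj2 surj2] := IH (loc M u) k.
split=> [[a b] [a' b'] /= [/inj1 -> /inj2 ->] //|[a b]].
by have [[a' <-] [b' <-]] := conj (surj1 a) (surj2 b); exists (a', b').
Qed.

Lemma cech_resl_inj us vs M k (z : cech (us ++ vs) M k) u :
  (forall y, y \in vs -> exists n, ideal_span us (y ^+ n)) ->
  cech_diff z = 0 -> @cech_resl R us vs M k z = cech_into u -> exists u', cech_into u' = z.
Proof.
elim: vs z => [|y vs IH] z vsus dz rz.
  have [inj _] := cech_resl_nil_bij us M k.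
  suff [u' Eu'] : exists u', cech_resl (@cech_into R (us ++ [::]) M k u') = cech_into u.
    by exists u'; apply: inj; rewrite Eu'.
  case: k z u dz rz inj => [|k] z u _ _ _; first by exists 0; rewrite !raddf0.
  have [u' Eu'] := (cech_resl_nil_bij us M k).2 u.
  by exists u'; rewrite /= cech_resl_diff Eu'.
have [n yn] := vsus y (mem_head _ _).
rewrite cech_resl_cons in rz; have [||u' Eu'] := IH _ _ _ rz.
- by move=> y' y'vs; apply: vsus; rewrite inE y'vs orbT.
- exact: cech_drop_cocycle.
apply: (@cech_drop_inj us y vs M k n z u') => //.
by apply: ideal_span_subseq yn => a; rewrite mem_cat => ->.
Qed.

Lemma cech_resl_lift us vs M k (c : cech us M k) :
  (forall y, y \in vs -> exists n, ideal_span us (y ^+ n)) -> cech_diff c = 0 ->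
  exists2 z : cech (us ++ vs) M k, cech_diff z = 0 & @cech_resl R us vs M k z = c.
Proof.
elim: vs => [|y vs IH] vsus dc.
  have [z Ez] := (cech_resl_nil_bij us M k).2 c; exists z => //.
  apply: (cech_resl_nil_bij us M k.+1).1.
  by rewrite cech_resl_diff Ez dc raddf0.
have [n yn] := vsus y (mem_head _ _).
have [|//|z dz rz] := IH.
  by move=> y' y'vs; apply: vsus; rewrite inE y'vs orbT.
have [||z' dz' Dz'] := @cech_drop_lift us y vs M k n z => //.
  by apply: ideal_span_subseq yn => a; rewrite mem_cat => ->.
by exists z' => //; rewrite cech_resl_cons Dz'.
Qed.

End Drop.

(** * Cohomology in the top degree *)

Section TopDegree.
Variable R : comNzRingType.
Implicit Types (M N : lmodType R) (x y r : R) (xs : seq R).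

(** The submodule (x_1^e, ..., x_k^e)M, by a recursion parallel to that of [cech]. *)
Fixpoint power_span xs e M : set M :=
  if xs is x :: xs' then
    [set a | exists b c, power_span xs' e c /\ a = x ^+ e *: b + c]
  else [set 0].

Lemma power_span_linear xs e M N (g : M -> N) a : linear g ->
  power_span xs e a -> power_span xs e (g a).
Proof.
move=> glin; have g0 : g 0 = 0 by rewrite -[0](addNr 0) -scaleN1r glin scaleN1r addNr.
elim: xs a => [|x xs IH] a /=; first by move=> ->.
by move=> [b [c [/IH gc ->]]]; exists (g b), (g c); rewrite glin.
Qed.

Lemma power_spanZ xs e M r (a : M) : power_span xs e a -> power_span xs e (r *: a).
Proof.
apply: (power_span_linear (g := fun b => r *: b)) => s b c.
by rewrite scalerDr !scalerA mulrC.
Qed.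

Lemma power_span_prod xs e k M (a : M) : power_span xs e a ->
  power_span xs (k + e) ((\prod_(y <- xs) y) ^+ k *: a).
Proof.
elim: xs a => [|x xs IH] a /=; first by move=> ->; rewrite scaler0.
move=> [b [c [/IH Pc ->]]]; rewrite big_cons exprMn.
exists ((\prod_(y <- xs) y) ^+ k *: b), (x ^+ k *: ((\prod_(y <- xs) y) ^+ k *: c)).
split; first exact: power_spanZ.
by rewrite scalerDr !scalerA exprD mulrAC.
Qed.

Lemma power_span_loc xs e M f (u : loc M f) : power_span xs e u ->
  exists l c, power_span xs e c /\ f ^+ l *: u = to_loc f c.
Proof.
have clear_den (b : M) n : f ^+ n *: frac f b n = to_loc f b.
  by rewrite fracZ /to_loc (frac_expand f b 0 n) addn0.
elim: xs u => [|x xs IH] u /=.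
  by move=> ->; exists 0%N, 0; rewrite scaler0 raddf0.
move=> [b [c [/IH[l [c' [Pc' Ec']]] ->]]]; have [b0 [n ->]] := fracP b.
exists (l + n)%N, (x ^+ e *: (f ^+ l *: b0) + f ^+ n *: c'); split.
  by exists (f ^+ l *: b0), (f ^+ n *: c'); split=> //; apply: power_spanZ.
have tZ r a : to_loc f (r *: a) = r *: to_loc f a :> loc M f by exact: linearZ_LR.
have tD a a' : to_loc f (a + a') = to_loc f a + to_loc f a' :> loc M f by exact: raddfD.
rewrite tD !tZ -Ec' -(clear_den b0 n) !scalerA scalerDr !scalerA !exprD.
by congr (_ *: _ + _ *: _); ring.
Qed.

(** For [k = size xs] this is a / (x_1 ... x_k)^n; otherwise it is 0. *)
Fixpoint cech_topn n xs M (a : M) k : cech xs M k :=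
  match xs, k return cech xs M k with
  | [::], 0 => a
  | [::], _.+1 => 0
  | x :: xs', 0 => 0
  | x :: xs', k'.+1 => (0, @cech_topn n xs' (loc M x) (frac x a n) k')
  end.

Lemma cech_top_topn xs M (a : M) k : cech_top xs a k = cech_topn 1 xs a k.
Proof. by elim: xs M a k => [|x xs IH] M a [|k] //=; rewrite IH. Qed.

Lemma cech_map_topn n xs M N (g : {linear M -> N}) a k :
  cech_map g (cech_topn n xs a k) = cech_topn n xs (g a) k.
Proof.
elim: xs M N g a k => [|x xs IH] M N g a [|k] //=; first exact: raddf0.
by rewrite raddf0 IH /= loc_funE.
Qed.

Lemma frac_linear M x n : linear (fun a : M => frac x a n).
Proof.
move=> r a b; rewrite fracZ fracD; apply/eqP/frac_eqP; exists 0%N.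
by rewrite !add0n -scalerDr scalerA -exprD.
Qed.

Lemma cech_topn_linear n xs M k : linear (fun a : M => cech_topn n xs a k).
Proof.
elim: xs M k => [|x xs IH] M [|k] r a b //=.
- by rewrite scaler0 addr0.
- by rewrite scaler0 addr0.
rewrite frac_linear IH.
set p := cech_topn _ _ _ _; set q := cech_topn _ _ _ _.
suff : (0, r *: p + q) = (r *: 0 + 0, r *: p + q) :> cech xs M k.+1 * cech xs (loc M x) k.
  by [].
by rewrite scaler0 addr0.
Qed.

Lemma cech_topn_expand n m xs M (a : M) k :
  cech_topn n xs a k = cech_topn (m + n) xs ((\prod_(y <- xs) y) ^+ m *: a) k.
Proof.
elim: xs M a k => [|x xs IH] M a [|k] //=; first by rewrite big_nil expr1n scale1r.
rewrite big_cons exprMn mulrC IH (frac_expand x a n m) fracZ scalerA.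
by [].
Qed.

Lemma cech_above xs M k (z : cech xs M k) : (size xs < k)%N -> z = 0.
Proof.
elim: xs M k z => [|x xs IH] M [|k] //= z; first by rewrite [z]thinmx0.
rewrite ltnS => lt_k; case: z => a b.
by rewrite (IH _ _ a (leqW lt_k)) (IH _ _ b lt_k).
Qed.

Lemma cech_topnP xs M k (z : cech xs M k) : size xs = k ->
  exists n (a : M), z = cech_topn n xs a k.
Proof.
elim: xs M k z => [|x xs IH] M [|k] //= z; first by exists 0%N, z.
case: z => a b [szk]; have [n [u ->]] := IH _ _ b szk.
have [a' [n' ->]] := fracP u; exists (n' + n)%N.
exists (x ^+ n *: ((\prod_(y <- xs) y) ^+ n' *: a')).
rewrite (cech_topn_expand n n') fracZ (frac_expand _ _ n' n) [(n' + n)%N]addnC.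
by rewrite (cech_above a) // szk.
Qed.

(** A summand x^n b cancels the denominator x^n, so its fraction comes from a component whose index
    set omits [x]. *)
Lemma power_span_boundary n xs M (a : M) k : size xs = k -> power_span xs n a ->
  exists u, cech_into u = cech_topn n xs a k.
Proof.
elim: xs M a k => [|x xs IH] M a [|k] //=; first by move=> _ ->; exists 0.
move=> [szk] [b [c [Pc ->]]].
have [w Ew] := IH _ _ k szk (power_span_linear (@frac_linear M x n) Pc).
exists (cone_inl x (cech_topn n xs b k) + cone_inr (- w)).
apply: etrans (cech_into_cone _ _) _.
rewrite raddfN opprK /= Ew cech_map_topn.
rewrite (cech_above (cech_diff _)) ?szk //.
congr pair.
have E : frac x (x ^+ n *: b) n = to_loc x b.
  by rewrite /to_loc (frac_expand x b 0 n) addn0.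
rewrite -[x ^+ n *: b]scale1r (frac_linear x n) (cech_topn_linear n xs k) !scale1r.
by rewrite E.
Qed.

Lemma cone_decomp y xs M k (z : cech (y :: xs) M k) :
  exists a b, z = cone_inl y a + cone_inr b.
Proof.
case: k z => [|k] z; first by exists z, 0; rewrite /= addr0.
case: z => a b; exists a, b => /=.
by suff : (a, b) = (a + 0, 0 + b) by []; rewrite addr0 add0r.
Qed.

(** Top cohomology is the direct limit of the M/(x_1^n, ..., x_k^n)M under multiplication by x_1 ...
    x_k, so an element that dies in the limit dies at a finite stage [t]. *)
Lemma boundary_power_span n xs M (a : M) k u : size xs = k ->
  cech_into u = cech_topn n xs a k ->
  exists t, power_span xs (t + n) ((\prod_(y <- xs) y) ^+ t *: a).
Proof.
elim: xs M a k n u => [|x xs IH] M a [|k] // n u.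
  by move=> _ /= <-; exists 0%N; rewrite scaler0.
move=> [szk]; have [a1 [b1 ->]] := cone_decomp (u : cech (x :: xs) M k).
move=> /(etrans (esym (cech_into_cone _ _)))/(congr1 snd) /= E.
have [j [a2 Ea]] := cech_topnP a1 szk.
pose P := \prod_(y <- xs) y.
(* The numerator, over the common denominator P^(j+n), of the difference between the given fraction
   and the contribution a2 / P^j of the components without [x]. *)
pose w := P ^+ j *: frac x a n - P ^+ n *: to_loc x a2.
have Ew : cech_into (- b1) = cech_topn (j + n) xs w k.
  have -> : w = -1 *: (P ^+ n *: to_loc x a2) + P ^+ j *: frac x a n.
    by rewrite /w addrC scaleN1r.
  rewrite cech_topn_linear scaleN1r -(cech_topn_expand n j) [(j + n)%N]addnC.
  rewrite -(cech_topn_expand j n) -cech_map_topn -Ea -E raddfN.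
  by rewrite addrA addNr add0r.
have [t Pt] := IH _ _ _ _ _ szk Ew.
have [l [c [Pc Ec]]] := power_span_loc Pt.
have fn : x ^+ n *: frac x a n = to_loc x a.
  by rewrite fracZ /to_loc (frac_expand x a 0 n) addn0.
have tZ r b : to_loc x (r *: b) = r *: to_loc x b :> loc M x by exact: linearZ_LR.
have tw : to_loc x (P ^+ j *: a - x ^+ n *: (P ^+ n *: a2)) = x ^+ n *: w.
  by rewrite raddfB /= !tZ -fn /w scalerBr !scalerA mulrC.
have : to_loc x ((x ^+ l * P ^+ t) *: (P ^+ j *: a - x ^+ n *: (P ^+ n *: a2)) - x ^+ n *: c) = 0.
  by rewrite raddfB /= !tZ tw -Ec !scalerA mulrC mulrA subrr.
move=> /frac_eq0[s]; rewrite !scalerBr !scalerA => /eqP.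
rewrite subr_eq0 subr_eq addrC => /eqP Es.
(* Multiplying [Es] by x^(t+j) P^(s+l) brings [x] and [P] to this common exponent. *)
exists (s + l + t + j)%N; rewrite /= big_cons -/P.
exists (P ^+ (s + l + t + n) *: a2), (x ^+ (s + n + t + j) *: (P ^+ (s + l) *: c)).
split.
  apply: power_spanZ; have -> : (s + l + t + j + n = s + l + (t + (j + n)))%N by lia.
  exact: power_span_prod.
have := congr1 (fun b => (x ^+ (t + j) * P ^+ (s + l)) *: b) Es.
rewrite /= scalerDr !scalerA !exprMn !exprD => E'.
by apply: (etrans _ (etrans E' _)); [|congr (_ *: _ + _ *: _)];
  try congr (_ *: _); ring.
Qed.

Lemma power_span_gen xs e (a : R^o) : power_span xs e a ->
  ideal_gen [set y ^+ e | y in [set` xs]] a.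
Proof.
elim: xs a => [|x xs IH] a /=.
  by move=> ->; apply: ideal0; apply: ideal_gen_ideal.
have iG := ideal_gen_ideal [set y ^+ e | y in [set` x :: xs]].
have Gx : ideal_gen [set y ^+ e | y in [set` x :: xs]] (x ^+ e).
  by apply: sub_ideal_gen; exists x => //=; apply: mem_head.
move=> [b [c [/IH Gc ->]]]; apply: (idealD iG (idealMR b iG Gx)).
apply: ideal_genS Gc => _ [y yxs <-]; exists y => //=.
by rewrite inE yxs orbT.
Qed.

End TopDegree.

(** * Frobenius and the top cohomology of an algebra *)

Lemma frobeniusD (A : comPzRingType) p n (a b : A) : prime p -> p%:R = 0 :> A ->
  (a + b) ^+ (p ^ n) = a ^+ (p ^ n) + b ^+ (p ^ n).
Proof.
move=> pr_p pA0; elim: n => [|n IH]; first by rewrite expn0 !expr1.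
rewrite expnSr !exprM IH; move: (a ^+ _) (b ^+ _) => {IH} {}a {}b.
have defp := prednK (prime_gt0 pr_p).
rewrite exprDn big_ord_recr subnn -defp big_ord_recl /= defp subn0 mulr1 mul1r.
rewrite bin0 binn !mulr1n big1 ?addr0 // => i _.
have /dvdnP[c ->] : (p %| 'C(p, bump 0 i))%N.
  by apply: prime_dvd_bin => //; rewrite /bump add1n /= -{2}defp ltnS (valP i).
by rewrite -mulr_natl natrM pA0 mulr0 mul0r.
Qed.

Section Frobenius.
Variables (R : comNzRingType) (A : comPzRingType) (phi : {rmorphism R -> A}).
Local Notation algA := (algebra_module phi).

Lemma power_span_frobenius (xs : seq R) e q (a : algA) :
  (forall b c : A, (b + c) ^+ q = b ^+ q + c ^+ q) -> (0 < q)%N ->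
  power_span xs e a -> power_span xs (e * q) ((a : A) ^+ q : algA).
Proof.
move=> frob q_gt0; elim: xs a => [|x xs IH] a /=.
  by move=> ->; rewrite expr0n -leqn0 leqNgt q_gt0.
move=> [b [c [/IH Pc ->]]]; exists ((b : A) ^+ q), ((c : A) ^+ q); split=> //.
rewrite frob; congr (_ + _).
by rewrite /GRing.scale /= /alg_scale exprMn -rmorphXn -exprM.
Qed.

(* If the class of 1/(x_1 ... x_d) vanishes, so do its images 1/(x_1 ... x_d)^q
   under the powers of Frobenius; these generate the top cohomology over [A]. *)
Lemma top_boundary_all p (xs : seq R) k u (z : cech xs algA k) :
  p \in [pchar R] -> size xs = k ->
  cech_into u = cech_top xs (1 : algA) k -> exists u', cech_into u' = z.
Proof.
move=> charR szk; rewrite cech_top_topn => /(boundary_power_span szk)[t Pt].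
have [n [a ->]] := cech_topnP z szk.
have p_gt1 : (1 < p)%N by apply: prime_gt1; apply: pcharf_prime charR.
(* A power of [p] that is at least the denominator exponent [n] of the class to be killed. *)
pose q := (p ^ n)%N.
have lt_nq : (n <= q)%N by apply/ltnW/ltn_expl.
have pr_p : prime p by apply: pcharf_prime charR.
have pA0 : p%:R = 0 :> A.
  by rewrite -(rmorph_nat phi) (pcharf0 charR) rmorph0.
have frob (b c : A) : (b + c) ^+ q = b ^+ q + c ^+ q by apply: frobeniusD.
have q_gt0 : (0 < q)%N by rewrite expn_gt0 prime_gt0.
pose P := \prod_(y <- xs) y.
have {}Pt : power_span xs ((t + 1) * q) (P ^+ (t * q) *: a : algA).
  have glin : linear (fun b : algA => (a : A) * (b : A) : algA).
    move=> r b c; rewrite /GRing.scale /= /alg_scale mulrDr; congr (_ + _).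
    by rewrite mulrCA.
  have := power_span_linear glin (power_span_frobenius frob q_gt0 Pt).
  rewrite /GRing.scale /= /alg_scale mulr1 -rmorphXn -exprM.
  by rewrite [(a : A) * _]mulrC.
(* The denominator exponent is raised from [n] to [q] and then to (t + 1) q; the numerator acquires
   the factor P^(t q), which Frobenius has placed in the span. *)
rewrite (cech_topn_expand n (q - n)) subnK // (cech_topn_expand q (t * q)).
apply: power_span_boundary => //.
rewrite scalerA mulrC -scalerA; apply: power_spanZ.
by rewrite addn1 mulSn addnC in Pt.
Qed.

End Frobenius.

(** * Paraclasses *)

Section ParameterGens.
Variables (R : comNzRingType) (m : set R).
Hypotheses (noethR : noetherian R) (localR : local_with_max m).

Lemma gens_span : ideal_span (gens m) = m.
Proof.
exact: (xgetPex [::] (noethR (max_ideal_ideal localR))).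
Qed.

Variables (d : nat) (x : d.-tuple R).
Hypothesis paramx : parameters m x.

Lemma parameters_max y : y \in x -> m y.
Proof.
move=> xy; have : zero_locus m m by split; [apply: max_ideal_prime | ].
by rewrite -paramx => -[_]; apply.
Qed.

Lemma parameters_prime P : prime_ideal P -> (forall y, y \in x -> P y) -> P = m.
Proof.
move=> pP xP; have : zero_locus [set` x] P by split.
rewrite paramx => -[_ mP]; apply/seteqP; split=> //.
exact: prime_sub_max.
Qed.

Lemma gens_nilpotent y : y \in gens m -> exists n, ideal_span x (y ^+ n).
Proof.
move=> gy; apply: (@zero_locus_nilpotent R m noethR _ y (ideal_span_ideal x)); last first.
  by rewrite -gens_span; apply: ideal_span_mem.
move=> P pP xP; apply: parameters_prime => // z xz.
by apply: xP; apply: ideal_span_mem.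
Qed.

Lemma parameters_nilpotent y : y \in x -> exists n, ideal_span (gens m) (y ^+ n).
Proof. by exists 1%N; rewrite expr1 gens_span; apply: parameters_max. Qed.

End ParameterGens.

Lemma cech_resr_map (R : comNzRingType) (us vs : seq R) (M N : lmodType R)
    (g : {linear M -> N}) k (a : cech (us ++ vs) M k) :
  @cech_resr R us vs N k (cech_map g a) = cech_map g (@cech_resr R us vs M k a).
Proof. by elim: us M N g k a => [|u us IH] M N g [|k] //= a; rewrite IH. Qed.

Theorem lemma1p6 (K : fieldType) (p : nat) (charK : p \in [pchar K])
    (R : comNzRingType) (structR : {rmorphism K -> R})
    (m : set R) (d : nat)
    (noethR : noetherian R) (localR : local_with_max m) (dimR : krull_dim R d)
    (A : comPzRingType) (phi : {rmorphism R -> A}) :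
  [<-> parasolid phi m d;
       exists c : local_cohomology m R^o d,
         paraclass c /\ lc_alg_map phi c <> 0;
       exists h : local_cohomology m (algebra_module phi) d, h <> 0].
Proof.
have charR : p \in [pchar R].
  rewrite inE (pcharf_prime charK) -(rmorph_nat structR) (pcharf0 charK).
  by rewrite rmorph0 eqxx.
tfae.
- move=> solidA; have [x paramx] := exists_parameters noethR localR dimR.
  have nilg := gens_nilpotent noethR localR paramx.
  have nilx := parameters_nilpotent noethR localR paramx.
  have dtop : cech_diff (cech_top x (1 : R^o) d) = 0.
    by apply/eqP; apply: cech_top_cocycle.
  (* The paraclass is built on the joint family: the cochain 1/(x_1 ... x_d) is lifted from the
     parameters, then restricted to the generators. *)
  have [z dz rz] := cech_resr_lift nilg dtop.
  pose Z : kernel (@cech_diff R (gens m ++ x) R^o d) := Sub z (introT eqP dz).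
  pose c : local_cohomology m R^o d := cech_H_resl (hclass (@cech_into R _ _ _) Z).
  have parac : paraclass c.
    exists x; split=> //; exists (hclass (@cech_into R _ _ _) Z); split=> //.
    by rewrite cech_H_resrE; congr hclass; apply: val_inj.
  exists c; split=> //; apply: solidA => //.
  rewrite /c cech_H_reslE => /eqP/hclass_eq0P[u Eu].
  (* Vanishing on the generators passes to the joint family, hence to 1/(x_1 ... x_d), against the
     monomial theorem. *)
  have [u' Eu'] := cech_resl_inj nilx dz (esym Eu).
  have [v Ev] := cech_resr_im u'.
  have [|t] := boundary_power_span (n := 1) (size_tuple x) (u := v) (a := 1 : R^o).
    by rewrite -cech_top_topn -Ev Eu' rz.
  rewrite addn1 => /power_span_gen; have -> : forall r : R, r *: (1 : R^o) = r by exact: mulr1.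
  apply: (monomial_notin noethR charR localR) dimR.1 (size_tuple x) _ _.
    by move=> a; apply: (parameters_max localR paramx).
  by move=> P; apply: (parameters_prime noethR localR paramx).
- move=> [c [_ nc]]; exists (lc_alg_map phi c); exact: nc.
(* By contradiction: if the image of one paraclass is zero, every class over [A] is zero, in
   particular [h]. *)
- move=> [h nh] c [x [paramx [e [<- re]]]] _ Ec; apply: nh.
  have nilg := gens_nilpotent noethR localR paramx.
  have nilx := parameters_nilpotent noethR localR paramx.
  have [Z EZ] := hclassP e; subst e.
  have dz : cech_diff (val Z) = 0 by apply/eqP; exact: valP Z.
  move: Ec; rewrite cech_H_reslE /lc_alg_map /lc_map cech_H_mapE.
  move=> /eqP/hclass_eq0P[u Eu].
  have [u' Eu'] : exists u', cech_into u' = cech_map (alg_map phi) (val Z).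
    apply: (cech_resl_inj nilx); first exact: cech_map_ker.
    by rewrite cech_resl_map; symmetry; exact: Eu.
  move: re; rewrite cech_H_resrE => /eqP/hclass_eqP[v Ev].
  have [v1 Ev1] := cech_map_im (alg_map phi) v.
  have [v2 Ev2] := cech_resr_im u'.
  (* On the parameters [Z] represents 1/(x_1 ... x_d) only up to the boundary of [v], whose image
     over [A] is subtracted. *)
  have topE : cech_into (v2 - v1) = cech_top x (1 : algebra_module phi) d.
    rewrite raddfB /= -Ev1 -Ev2 Eu' cech_resr_map Ev raddfB /= subKr.
    by rewrite !cech_top_topn cech_map_topn /= /alg_map rmorph1.
  have [W EW] := hclassP h; rewrite EW; apply/eqP/hclass_eq0P.
  have dw : cech_diff (val W) = 0 by apply/eqP; exact: valP W.
  have [w dw' rw] := cech_resl_lift nilx dw.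
  (* Over the parameters every cochain of degree [d] is now a boundary; injectivity carries this to
     the lift of [W] on the joint family, and restriction carries it to [W]. *)
  have [w1 Ew1] := top_boundary_all (cech_resr w) charR (size_tuple x) topE.
  have [w2 Ew2] := cech_resr_inj nilg dw' (esym Ew1).
  have [w3 Ew3] := cech_resl_im w2.
  by exists w3; apply: etrans (esym Ew3) _; rewrite Ew2.
Qed.
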